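(* For every $n\geq 1$ there exists a bijection $\Psi:\mathbf{I}_n(021)\to\mathfrak{S}_n(2413,4213)$ such that for every $e\in\mathbf{I}_n(021)$, with $\pi=\Psi(e)$, $$\big(\mathrm{DIST}(e),\mathrm{ASC}(e),\mathrm{ZERO}(e),\mathrm{EMA}(e),\mathrm{RMI}(e),\mathrm{EXPO}(e)\big)=\big(\mathrm{VID}(\pi),\mathrm{DES}(\pi),\mathrm{LMA}(\pi),\mathrm{LMI}(\pi),\mathrm{RMA}(\pi),\mathrm{RMI}(\pi)\big).$$
   Context: $\mathbf{I}_n=\{(e_1,\dots,e_n)\in\mathbb{Z}^n: 0\le e_i\le i-1\}$ is the set of inversion sequences of length $n$; $\mathfrak{S}_n$ is the set of permutations $\pi=\pi_1\cdots\pi_n$ of $[n]=\{1,\dots,n\}$. Both are regarded as words. A word $W=w_1\cdots w_n$ contains a pattern $P=p_1\cdots p_k$ if some subword $w_{i_1}\cdots w_{i_k}$ ($i_1<\dots<i_k$) is order isomorphic to $P$ (i.e. $w_{i_a}<w_{i_b}$ iff $p_a<p_b$ and $w_{i_a}=w_{i_b}$ iff $p_a=p_b$); otherwise $W$ avoids $P$. For a set $\mathcal W$ of words, $\mathcal W(P_1,\dots,P_r)$ is the set of words in $\mathcal W$ avoiding all $P_j$. Statistics on $\pi\in\mathfrak{S}_n$: $\mathrm{DES}(\pi)=\{i\in[n-1]:\pi_i>\pi_{i+1}\}$; $\mathrm{VID}(\pi)=\{i\in[n]:\pi_i<n \text{ and the value }\pi_i+1\text{ appears at a position to the left of } i\}$;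 $\mathrm{LMA}(\pi)=\{i:\pi_i>\pi_j \ \forall j<i\}$; $\mathrm{LMI}(\pi)=\{i:\pi_i<\pi_j\ \forall j<i\}$; $\mathrm{RMA}(\pi)=\{i:\pi_i>\pi_j\ \forall j>i\}$; $\mathrm{RMI}(\pi)=\{i:\pi_i<\pi_j\ \forall j>i\}$. Statistics on $e\in\mathbf{I}_n$: $\mathrm{ASC}(e)=\{i\in[n-1]:e_i<e_{i+1}\}$; $\mathrm{DIST}(e)=\{2\le i\le n: e_i\ne 0 \text{ and } e_i\neq e_j \ \forall j>i\}$; $\mathrm{ZERO}(e)=\{i:e_i=0\}$; $\mathrm{EMA}(e)=\{i:e_i=i-1\}$; $\mathrm{RMI}(e)=\{i: e_i<e_j\ \forall j>i\}$. Exposed positions: for $e\in\mathbf{I}_n(021)$ define $d_i=e_i$ if $e_i\ne0$ and $d_i=\max\{e_1,\dots,e_i\}$ if $e_i=0$. Let $\mathcal{C}(e)=\{i: e_i=0 \text{ and there exist } a<i<b \text{ with } e_a=e_b\neq 0\}$. Then $\mathrm{EXPO}(e)=\{i\in[n]: i\notin\mathcal C(e)\text{ and } i-d_i<j-d_j \text{ for all } j \text{ with } i<j\le n\}$. *)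

(* Defs.v *)
(* Words are [seq nat]; positions are 1-indexed as in the paper. *)
From mathcomp Require Import all_boot.
Set Implicit Arguments. Unset Strict Implicit. Unset Printing Implicit Defensive.

Definition letter (w : seq nat) (i : nat) : nat := nth 0 w i.-1.

Definition order_iso (u p : seq nat) : Prop :=
  size u = size p /\
  forall a b, a < size p -> b < size p ->
    (nth 0 u a < nth 0 u b = (nth 0 p a < nth 0 p b)) /\
    ((nth 0 u a == nth 0 u b) = (nth 0 p a == nth 0 p b)).

Definition contains (w p : seq nat) : Prop :=
  exists m : bitseq, size m = size w /\ order_iso (mask m w) p.

Definition avoids (w p : seq nat) : Prop := ~ contains w p.

Definition is_invseq (n : nat) (e : seq nat) : Prop :=
  size e = n /\ forall i, 1 <= i <= n -> letter e i <= i - 1.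

Definition is_perm (n : nat) (p : seq nat) : Prop := perm_eq p (iota 1 n).

Definition I021 (n : nat) (e : seq nat) : Prop :=
  is_invseq n e /\ avoids e [:: 0; 2; 1].
Definition S2413_4213 (n : nat) (p : seq nat) : Prop :=
  is_perm n p /\ avoids p [:: 2; 4; 1; 3] /\ avoids p [:: 4; 2; 1; 3].

(* a set of positions of w, represented as the increasing list of the
   positions i in [1, size w] satisfying P *)
Definition posset (w : seq nat) (P : nat -> bool) : seq nat :=
  [seq i <- iota 1 (size w) | P i].

Definition DES (p : seq nat) : seq nat :=
  posset p (fun i => (i <= size p - 1) && (letter p i > letter p i.+1)).
Definition posof (p : seq nat) (v : nat) : nat := (index v p).+1.
Definition VID (p : seq nat) : seq nat :=
  posset p (fun i => (letter p i < size p) && (posof p (letter p i).+1 < i)).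
Definition LMA (p : seq nat) : seq nat :=
  posset p (fun i => [forall j : 'I_(size p).+1, (0 < j < i) ==> (letter p j < letter p i)]).
Definition LMI (p : seq nat) : seq nat :=
  posset p (fun i => [forall j : 'I_(size p).+1, (0 < j < i) ==> (letter p i < letter p j)]).
Definition RMA (p : seq nat) : seq nat :=
  posset p (fun i => [forall j : 'I_(size p).+1, (i < j) ==> (letter p j < letter p i)]).
Definition RMIp (p : seq nat) : seq nat :=
  posset p (fun i => [forall j : 'I_(size p).+1, (i < j) ==> (letter p i < letter p j)]).

Definition ASC (e : seq nat) : seq nat :=
  posset e (fun i => (i <= size e - 1) && (letter e i < letter e i.+1)).
Definition DIST (e : seq nat) : seq nat :=
  posset e (fun i => (2 <= i) && (letter e i != 0) &&
    [forall j : 'I_(size e).+1, (i < j) ==> (letter e i != letter e j)]).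
Definition ZERO (e : seq nat) : seq nat := posset e (fun i => letter e i == 0).
Definition EMA (e : seq nat) : seq nat := posset e (fun i => letter e i == i - 1).
Definition RMIe (e : seq nat) : seq nat :=
  posset e (fun i => [forall j : 'I_(size e).+1, (i < j) ==> (letter e i < letter e j)]).

Definition dval (e : seq nat) (i : nat) : nat :=
  if letter e i != 0 then letter e i else \max_(j <- take i e) j.
Definition covered (e : seq nat) (i : nat) : bool :=
  (letter e i == 0) &&
  [exists a : 'I_(size e).+1, exists b : 'I_(size e).+1,
     [&& 0 < a, a < i, i < b, letter e a == letter e b & letter e a != 0]].
Definition EXPO (e : seq nat) : seq nat :=
  posset e (fun i => ~~ covered e i &&
    [forall j : 'I_(size e).+1, (i < j) ==> (i - dval e i < j - dval e j)]).

(* Main.v *)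
(* Both classes are generated by the same recursion, so that the objects of length [n] on each side
   are encoded by trees with constructors [Leaf], [Under], [Glue], and [Psi] passes through the tree.
   On a permutation, let [1] stand at position [k + 1]. If [k = 0], remove it ([Under]). If [k > 0],
   avoidance of 2413 and 4213 forces the [k] entries before [1] to form an interval of values;
   this interval is an arbitrary permutation of the class, and collapsing it to one point and
   deleting [1] leaves another arbitrary permutation [x :: R] of the class ([Glue]).
   On an inversion sequence, let [e_(k+1) = k] be the last maximal entry. If [k = 0], remove the
   leading [0] ([Under]). If [k > 0], the prefix of length [k] is an arbitrary sequence of the class,
   and after it every entry is [0] or at least [k]; shifting the nonzero entries after the pivot by a
   common amount and prepending [0] yields the second sequence ([Glue]). The amount is read off from
   whether [k] recurs, which is equivalent to [x > 1] and to the second sequence having a maximal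
   entry besides its first one. All six statistics obey the same recursion on both sides. *)
Require Import Defs.
From Stdlib Require Import ClassicalEpsilon.
From mathcomp Require Import all_boot.
From mathcomp Require Import zify.
Set Implicit Arguments. Unset Strict Implicit. Unset Printing Implicit Defensive.

(** * Words cut at a pivot letter *)

Section ThreeZones.
Variables (u : seq nat) (a : nat) (v : seq nat).
Let w := u ++ a :: v.

Lemma nth_zoneL i : i < size u -> nth 0 w i = nth 0 u i.
Proof. by rewrite nth_cat => ->. Qed.

Lemma take_zoneL i : i < size u -> take i w = take i u.
Proof. by move=> h; rewrite takel_cat // ltnW. Qed.

Lemma drop_zoneL i : i < size u -> drop i.+1 w = drop i.+1 u ++ a :: v.
Proof.
rewrite /w drop_cat leq_eqVlt => /orP[/eqP E|->] //.
by rewrite E ltnn subnn drop0 drop_size.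
Qed.

Lemma nth_zoneM : nth 0 w (size u) = a.
Proof. by rewrite nth_cat ltnn subnn. Qed.

Lemma take_zoneM : take (size u) w = u.
Proof. by rewrite take_size_cat. Qed.

Lemma drop_zoneM : drop (size u).+1 w = v.
Proof. by rewrite drop_cat ltnNge leqnSn /= subSnn /= drop0. Qed.

Lemma nth_zoneR j : nth 0 w (size u + j.+1) = nth 0 v j.
Proof. by rewrite nth_cat ltnNge leq_addr addKn. Qed.

Lemma take_zoneR j : take (size u + j.+1) w = u ++ a :: take j v.
Proof. by rewrite take_cat ltnNge leq_addr addKn. Qed.

Lemma drop_zoneR j : drop (size u + j.+1).+1 w = drop j.+1 v.
Proof. by rewrite drop_cat ltnNge -addnS leq_addr addKn. Qed.

Lemma zoneP i : i < size w ->
  [\/ i < size u, i = size u | exists2 j, j < size v & i = size u + j.+1].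
Proof.
rewrite size_cat /= => hi; case: (ltngtP i (size u)) => h.
- by constructor 1.
- constructor 3; exists (i - size u).-1; lia.
- by constructor 2.
Qed.
End ThreeZones.

(** * The statistics at 0-indexed positions, and prefix maxima *)

Definition desc w i := (i.+1 < size w) && (nth 0 w i.+1 < nth 0 w i).
Definition asc w i := (i.+1 < size w) && (nth 0 w i < nth 0 w i.+1).
Definition vid w i := (nth 0 w i).+1 \in take i w.
Definition dist w i := (nth 0 w i != 0) && (nth 0 w i \notin drop i.+1 w).
Definition lmax w i := all (fun y => y < nth 0 w i) (take i w).
Definition lmin w i := all (fun y => nth 0 w i < y) (take i w).
Definition rmax w i := all (fun y => y < nth 0 w i) (drop i.+1 w).
Definition rmin w i := all (fun y => nth 0 w i < y) (drop i.+1 w).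
(** Stands for $d_i$ at zero and nonzero entries alike: when the nonzero entries increase weakly, a
    nonzero entry is its own prefix maximum. *)
Definition pmax w i := \max_(y <- take i.+1 w) y.
Definition cov w i :=
  (nth 0 w i == 0) && has (fun y => (y != 0) && (y \in drop i.+1 w)) (take i w).
Definition expo w i := ~~ cov w i &&
  [forall j : 'I_(size w), (i < j) ==> (i.+1 - pmax w i < j.+1 - pmax w j)].

Definition invs w := forall i, i < size w -> nth 0 w i <= i.
(** For inversion sequences this is avoidance of 021, as [avoids_021] shows. *)
Definition nzinc w := pairwise (fun x y => (y == 0) || (x <= y)) w.

Lemma expoP w i : reflect
  (~~ cov w i /\ forall j, i < j < size w -> i.+1 - pmax w i < j.+1 - pmax w j)
  (expo w i).
Proof.
apply: (iffP andP) => -[hc h]; split=> //.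
  move=> j /andP[ij jw]; exact: (implyP (forallP h (Ordinal jw)) ij).
by apply/forallP => j; apply/implyP => ij; apply: h; rewrite ij /=.
Qed.

(* [nthP] and [mem_nth] at [T := nat]: their sizes would otherwise carry an [Equality.sort] that
   [lia] does not identify with [nat]. *)
Lemma nthnP (w : seq nat) y : reflect (exists2 i, i < size w & nth 0 w i = y) (y \in w).
Proof. exact: nthP. Qed.

Lemma mem_nthn (w : seq nat) i : i < size w -> nth 0 w i \in w.
Proof. exact: mem_nth. Qed.

Lemma bigmax_ub (l : seq nat) y : y \in l -> y <= \max_(z <- l) z.
Proof. by move=> h; apply: (@leq_bigmax_seq _ l xpredT id). Qed.

Lemma bigmax_le (l : seq nat) b : (forall y, y \in l -> y <= b) -> \max_(z <- l) z <= b.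
Proof. by move=> h; apply/bigmax_leqP_seq => y yl _; apply: h. Qed.

Lemma pmax_ge w i j : j <= i -> nth 0 w j <= pmax w i.
Proof.
move=> ji; case: (ltnP j (size w)) => h; last by rewrite nth_default.
have <- : nth 0 (take i.+1 w) j = nth 0 w j by rewrite nth_take.
by apply/bigmax_ub/mem_nthn; rewrite size_take; case: ifP; lia.
Qed.

Lemma pmax_le w i b : (forall j, j <= i -> j < size w -> nth 0 w j <= b) -> pmax w i <= b.
Proof.
move=> h; apply: bigmax_le => y /nthnP[j]; rewrite size_take => hj <-.
rewrite nth_take; last by move: hj; case: ifP; lia.
by apply: h; move: hj; case: ifP; lia.
Qed.

Lemma pmax_mono w i j : i <= j -> pmax w i <= pmax w j.
Proof. by move=> ij; apply: pmax_le => l li _; apply: pmax_ge; lia. Qed.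

Lemma pmax_inv w i : invs w -> pmax w i <= i.
Proof. by move=> h; apply: pmax_le => j ji /h; lia. Qed.

Lemma nzincP w : reflect
  (forall i j, i < j < size w -> nth 0 w j = 0 \/ nth 0 w i <= nth 0 w j) (nzinc w).
Proof.
apply: (iffP (pairwiseP 0)) => h i j.
  by case/andP=> ij jw; case/orP: (h i j (ltn_trans ij jw) jw ij) => [/eqP|]; auto.
by move=> iw jw ij; apply/orP; case: (h i j) => [||]; [exact/andP | move/eqP; auto | auto].
Qed.

Lemma pmax_nz w i : nzinc w -> nth 0 w i != 0 -> pmax w i = nth 0 w i.
Proof.
move=> /nzincP h nz; apply/eqP; rewrite eqn_leq pmax_ge // andbT.
apply: pmax_le => j; rewrite leq_eqVlt => /orP[/eqP->//|ji] jw.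
have iw : i < size w by rewrite ltnNge; apply/negP => /(nth_default 0) E; rewrite E in nz.
by case: (h j i) => [|E|//]; [rewrite ji iw | rewrite E in nz].
Qed.

(** * Inversion sequences *)

(** With [c = 0] the nonzero entries land strictly above the pivot value [k]; with [c] the least
    nonzero entry, the pivot value recurs. *)
Definition raise k c z := if z == 0 then 0 else z - c + k.
Definition glueE P g c := P ++ size P :: map (raise (size P) c) (behead g).

Section GlueInv.
Variables (P s : seq nat) (c : nat).
Let g := 0 :: s.
Let K := size P.
Let f := raise K c.
Let e := glueE P g c.
Hypothesis (K0 : 0 < K) (iP : invs P) (sP : nzinc P) (ig : invs g) (sg : nzinc g).
(** [c_le] makes the truncated subtraction in [raise] exact, [c_gt] keeps every entry after the
    pivot from being maximal, and [c_touch] ties a positive shift to a recurring pivot value and to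
    a maximal entry of [g] besides its first. *)
Hypothesis c_le : forall z, z \in s -> z != 0 -> c <= z.
Hypothesis c_gt : forall j, j < size s -> nth 0 s j < j.+1 + c.
Hypothesis c_touch : 0 < c -> c \in s /\ exists2 t, t < size s & nth 0 s t = t.+1.

Let eE : e = P ++ K :: map f s. Proof. by []. Qed.

Let eZone i : i < size e ->
  [\/ i < K, i = K | exists2 j, j < size s & i = K + j.+1].
Proof. by rewrite eE => /zoneP; rewrite size_map. Qed.

Let eqKj j : (K + j.+1 == K) = false.
Proof. lia. Qed.

Let ltKj j : (K + j.+1 < K) = false.
Proof. lia. Qed.

Let f0 : f 0 = 0. Proof. by []. Qed.

Let f_nz z : z != 0 -> f z = z - c + K. Proof. by rewrite /f /raise => /negbTE->. Qed.

Let f_eq0 z : (f z == 0) = (z == 0).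
Proof. by case: (eqVneq z 0) => [->//|/f_nz->]; lia. Qed.

Let f_inj : {in s &, injective f}.
Proof.
move=> x y xs ys; have := c_le xs; have := c_le ys; rewrite /f /raise.
case: eqP => ?; case: eqP => ?; lia.
Qed.

Let nth_f j : nth 0 (map f s) j = f (nth 0 s j).
Proof.
case: (ltnP j (size s)) => h; first exact: nth_map.
by rewrite !nth_default // size_map.
Qed.

Let mem_f j m : j < size s -> (f (nth 0 s j) \in map f (drop m s)) = (nth 0 s j \in drop m s).
Proof.
move=> h; apply/mapP/idP => [[y yd]|hd]; last by exists (nth 0 s j).
by move/f_inj => -> //; [exact: mem_nthn | exact: mem_drop yd].
Qed.

Let f_lt x y : x \in s -> y \in s -> (f x < f y) = (x < y).
Proof.
move=> xs ys; have := c_le xs; have := c_le ys; rewrite /f /raise.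
case: eqP => ?; case: eqP => ?; lia.
Qed.

Let P_lt y : y \in P -> y < K.
Proof. by case/nthnP => i hi <-; apply: leq_ltn_trans (iP hi) hi. Qed.

Let f_ltS j : j < size s -> f (nth 0 s j) < K + j.+1.
Proof.
move=> h; have := c_gt h; have := c_le (mem_nthn h); rewrite /f /raise.
by case: eqP => ?; lia.
Qed.

Lemma glueE_invs : invs e.
Proof.
move=> i; rewrite eE => /zoneP[h|->|[j]].
- by rewrite nth_zoneL // iP.
- by rewrite nth_zoneM.
- by rewrite size_map => h ->; rewrite nth_zoneR nth_f ltnW // f_ltS.
Qed.

Lemma glueE_nzinc : nzinc e.
Proof.
have fge z : z \in s -> (f z == 0) || (K <= f z).
  by case: (eqVneq z 0) => [->//|nz] _; rewrite f_nz // leq_addl orbT.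
rewrite eE /nzinc pairwise_cat -/(nzinc P) sP /=; apply/and3P; split.
- apply/allrelP => x y /P_lt xP; rewrite inE => /orP[/eqP->|]; first by apply/orP; lia.
  by case/mapP => z /fge h ->; case/orP: h => [->//|h]; apply/orP; right; lia.
- by apply/allP => _ /mapP[z /fge h ->].
- rewrite pairwise_map; apply/(pairwiseP 0) => i j; rewrite !inE => hi hj ij.
  have := nzincP _ sg i.+1 j.+1; rewrite /= !ltnS ij => /(_ hj) h.
  case: h => [->|h]; rewrite /relpre ?f0 ?eqxx //.
  apply/orP; right; rewrite leqNgt f_lt ?mem_nthn //; lia.
Qed.

(** There is always an ascent into the pivot, as [P] lies below [K], and never one out of it, as the
    next entry is at most [K]. *)
Lemma glueE_asc i : i < size e ->
  asc e i = if i < K then (i.+1 == K) || asc P i else (K < i) && asc g (i - K).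
Proof.
have se : size e = K + (size s).+1 by rewrite size_cat /= size_map.
case/eZone=> [h|->|[j h ->]]; rewrite /asc se eE.
- rewrite h nth_zoneL //; case: eqP => [->|ne].
    by rewrite nth_zoneM (_ : nth 0 P i < K) ?andbT; [lia | apply/P_lt/mem_nthn].
  by rewrite nth_zoneL; lia.
- rewrite ltnn /= nth_zoneM; have := nth_zoneR P K (map f s) 0; rewrite addn1 => ->.
  rewrite nth_f.
  by case: (posnP (size s)) => h; [lia | have := f_ltS h; lia].
- rewrite ltKj -addnS !nth_zoneR !nth_f addKn.
  rewrite (_ : K < K + j.+1) /=; last lia.
  rewrite !ltnS; case: (ltnP j.+1 (size s)) => h2; last by lia.
  by rewrite f_lt ?mem_nthn //; lia.
Qed.

(** The pivot value recurs exactly when [c > 0], being then the image of [c]. Entries of [P] lie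
    below [K], so a nonzero one can recur only inside [P]. *)
Lemma glueE_dist i : i < size e ->
  dist e i = if i < K then dist P i else if i == K then c == 0 else dist g (i - K).
Proof.
case/eZone=> [h|->|[j h ->]]; rewrite /dist eE.
- rewrite h nth_zoneL // drop_zoneL // mem_cat inE.
  have hP := P_lt (mem_nthn h); case: (eqVneq (nth 0 P i) 0) => [->//|nz] /=.
  congr (~~ _); rewrite [X in _ || X](_ : _ = false) ?orbF //.
  apply/norP; split; first lia.
  apply/mapP => -[z zs]; rewrite /f /raise; case: eqP => _; lia.
- rewrite ltnn eqxx nth_zoneM drop_zoneM -lt0n K0 /=.
  case: (posnP c) => [c0|cp].
    apply/mapP => -[z _]; rewrite /f /raise; case: eqP; lia.
  have [cs _] := c_touch cp.
  apply/negbTE/negPn/mapP; exists c => //; rewrite f_nz; lia.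
- rewrite ltKj eqKj nth_zoneR drop_zoneR nth_f f_eq0 addKn /= -map_drop mem_f //.
Qed.

Lemma glueE_zero i : i < size e ->
  (nth 0 e i == 0) = if i < K then nth 0 P i == 0 else (K < i) && (nth 0 g (i - K) == 0).
Proof.
case/eZone=> [h|->|[j h ->]]; rewrite eE.
- by rewrite h nth_zoneL.
- by rewrite ltnn nth_zoneM; lia.
- rewrite ltKj nth_zoneR nth_f f_eq0 addKn /=; lia.
Qed.

(** By [f_ltS] no entry after the pivot is maximal, so the pivot is the last maximal entry. *)
Lemma glueE_ema i : i < size e ->
  (nth 0 e i == i) = if i < K then nth 0 P i == i else i == K.
Proof.
case/eZone=> [h|->|[j h ->]]; rewrite eE.
- by rewrite h nth_zoneL.
- by rewrite ltnn nth_zoneM eqxx.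
- rewrite ltKj nth_zoneR nth_f.
  have := f_ltS h; lia.
Qed.

(** For an entry of [P] the suffix matters only through the absence of zeros, which is [rmin g 0].
    The letter following the pivot is at most [K], so the pivot qualifies only as last letter. *)
Lemma glueE_rmin i : i < size e ->
  rmin e i = if i < K then rmin P i && rmin g 0
             else if i == K then size s == 0 else rmin g (i - K).
Proof.
case/eZone=> [h|->|[j h ->]]; rewrite /rmin eE.
- rewrite h nth_zoneL // drop_zoneL // all_cat /= (P_lt (mem_nthn h)) /= drop0.
  congr (_ && _); rewrite all_map; apply: eq_in_all => z zs /=.
  have := P_lt (mem_nthn h); rewrite /f /raise; case: eqP => ?; lia.
- rewrite ltnn eqxx nth_zoneM drop_zoneM all_map.
  case: (s) f_ltS => //= z t /(_ 0 isT) /= hz; lia.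
- rewrite ltKj eqKj nth_zoneR drop_zoneR nth_f addKn /= -map_drop all_map.
  by apply: eq_in_all => z /mem_drop zs /=; rewrite f_lt // mem_nthn.
Qed.

(** As long as only zeros of [s] have been read, the truncated subtraction gives 0 and the maximum
    is the pivot value. *)
Lemma glueE_pmax j : j < size s -> pmax e (K + j.+1) = K + (pmax g j.+1 - c).
Proof.
move=> hj; rewrite /pmax eE -addnS take_zoneR big_cat big_cons /= big_cons.
have: {subset take j.+1 s <= s} by move=> z; apply: mem_take.
rewrite -map_take max0n; elim: (take j.+1 s) => [|z t IH] /= sub.
  have : \max_(y <- P) y <= K by apply: bigmax_le => y /P_lt; lia.
  rewrite !big_nil; lia.
have zs: z \in s by apply: sub; rewrite inE eqxx.
have := c_le zs; have {}IH := IH (fun y yt => sub y (mem_behead (s := z :: t) yt)).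
rewrite !big_cons; move: IH; rewrite /f /raise; set A := \max_(_ <- P) _.
set B := \max_(_ <- t) _; set C := \max_(_ <- _) _; case: eqP => ?; lia.
Qed.

(** The difference $i-d_i$ is 1 at the pivot, at least 1 before it and at least 2 after it. This
    settles the positions up to the pivot; later ones are compared with [g]. *)
Lemma glueE_expo i : i < size e ->
  expo e i = if i < K then false else (i == K) || expo g (i - K).
Proof.
have hK : pmax e K = K.
  rewrite pmax_nz ?glueE_nzinc // eE nth_zoneM //; lia.
have se : size e = K + (size s).+1 by rewrite size_cat /= size_map.
have pgt j : j < size s -> pmax g j.+1 < j.+1 + c.
  move=> hj; have: pmax g j.+1 <= j + c; last lia.
  by apply: pmax_le => -[|l] //= lj hl; have := c_gt (j := l); lia.
case/eZone=> [h|->|[j hj ->]].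
- rewrite h; apply/expoP => -[_ /(_ K)]; have := pmax_inv i glueE_invs; rewrite -/e hK; lia.
- rewrite ltnn eqxx; apply/expoP; split; first by rewrite /cov eE nth_zoneM; lia.
  rewrite hK => j /andP[Kj]; rewrite se => hj.
  have hj' : j.-1 - K < size s by lia.
  have -> : j = K + (j.-1 - K).+1 by lia.
  rewrite glueE_pmax //; have := pgt _ hj'; lia.
- rewrite ltKj eqKj addKn /=.
  (* Once the prefix maximum of [g] has reached [c], the differences in [e] and in [g] are offset by
     the constant [c] from here on, so it remains to match the coverings. *)
  case: (leqP c (pmax g j.+1)) => hM.
    have hcov : cov e (K + j.+1) = cov g j.+1.
      rewrite /cov eE nth_zoneR drop_zoneR take_zoneR nth_f f_eq0 /= -map_drop -map_take.
      case: eqVneq => //= z0; rewrite has_cat /= has_map.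
      have -> : has (fun y => (y != 0) && (y \in map f (drop j.+1 s))) P = false.
        apply/negP => /hasP[y yP /andP[y0 /mapP[z _]]]; have := P_lt yP.
        by rewrite /f /raise; case: eqP; lia.
      rewrite orFb; set h1 := has _ _; set h2 := has _ _.
      have -> : h1 = h2.
        apply: eq_in_has => z /mem_take zs /=; rewrite f_eq0; congr (_ && _).
        by have /nthnP[l hl <-] := zs; rewrite mem_f.
      (* The only new way to be covered is by the pivot value. If [K] recurs later, then [c] recurs
         in [g]; the prefix already holds a nonzero entry at least [c], which equals [c] by weak
         increase and covers the position in [g]. *)
      apply/orb_idl => /andP[_ /mapP[z zd]] Kz.
      have zs := mem_drop zd; have cz := c_le zs.
      have {cz} [zc c0]: z = c /\ c != 0.
        by move: Kz cz K0; rewrite /f /raise; clear; case: eqP; lia.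
      rewrite {}zc in zd.
      have [y yt yc]: exists2 y, y \in take j.+1 s & c <= y.
        case: (boolP (has (leq c) (take j.+1 s))) => [/hasP[y]|/hasPn hn]; first by exists y.
        suff: pmax g j.+1 <= c.-1 by move: hM c0; clear; lia.
        by apply: bigmax_le => y; rewrite inE => /orP[/eqP->//|/hn]; clear; lia.
      have yj : y \in take j s.
        move: yt; rewrite (take_nth 0) // mem_rcons inE => /orP[/eqP yE|//].
        by move: yc; rewrite yE z0 leqNgt lt0n c0.
      apply/hasP; exists y => //.
      have -> : y = c; last by rewrite c0.
      move: sg; rewrite /g /nzinc /= => /andP[_]; rewrite -(cat_take_drop j.+1 s) pairwise_cat.
      case/andP => /allrelP /(_ y c yt zd) /orP[/eqP c00|yc'] _; first by rewrite c00 in c0.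
      by apply/eqP; rewrite eqn_leq yc yc'.
    apply/expoP/expoP; rewrite hcov => -[? hlt]; split=> // [[|l]] /andP[jl].
    - by [].
    - rewrite /= ltnS => hl; have := hlt (K + l.+1); rewrite se !glueE_pmax //.
      have := pgt _ hj; have := pgt _ hl; have := pmax_mono g (ltnW jl).
      have := pmax_inv j.+1 ig; have := pmax_inv l.+1 ig; lia.
    - lia.
    rewrite se => hl; have hl' : l - K < size s by lia.
    have lE : l.+1 = K + (l - K).+1 by lia.
    rewrite lE !glueE_pmax //; have := hlt (l - K).+1; have := pgt _ hj; have := pgt _ hl'.
    have := @pmax_mono g j.+1 (l - K).+1; rewrite /=.
    have := pmax_inv j.+1 ig; have := pmax_inv (l - K).+1 ig; lia.
  (* Here [s] has only zeros so far and neither side is exposed: in [g] the maximal entry at [t.+1]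
     comes later and has difference at most 1, while in [e] the position lies between two
     occurrences of [K]. *)
  have c0 : 0 < c by lia.
  have [cs [t ht st]] := c_touch c0.
  have M0 : pmax g j.+1 = 0.
    apply/eqP; rewrite -leqn0; apply: pmax_le => -[|l] //= lj hl.
    have := pmax_ge g lj; have := c_le (mem_nthn (_ : l < size s)); rewrite /=; lia.
  have -> : expo g j.+1 = false.
    apply/expoP => -[_ /(_ t.+1)]; rewrite M0.
    have := pmax_ge g (leqnn t.+1); rewrite /= st => h1.
    case: (leqP t j) => h2; last lia.
    have := @pmax_ge g j.+1 t.+1; rewrite M0 /= st; lia.
  apply/andP => -[/negP h _]; apply: h; rewrite /cov eE nth_zoneR drop_zoneR take_zoneR nth_f f_eq0.
  have := @pmax_ge g j.+1 j.+1; rewrite M0 /= leqn0 => -> //=.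
  apply/hasP; exists K; first by rewrite mem_cat inE eqxx orbT.
  rewrite -lt0n K0 -map_drop /=; apply/mapP; exists c; last by rewrite f_nz; lia.
  move: cs; rewrite -{1}(cat_take_drop j.+1 s) mem_cat => /orP[ct|//].
  suff: c <= pmax g j.+1 by lia.
  by apply: bigmax_ub; rewrite /= inE ct orbT.
Qed.
End GlueInv.

(** * Prepending a zero to an inversion sequence *)

Section UnderInv.
Variable g : seq nat.
Hypothesis (g0 : 0 < size g) (ig : invs g) (sg : nzinc g).

Let gh : nth 0 g 0 = 0.
Proof. by have := ig g0; case: (nth _ _ _). Qed.

Lemma underE_invs : invs (0 :: g).
Proof. by case=> //= i; rewrite ltnS => /ig/leqW. Qed.

Lemma underE_nzinc : nzinc (0 :: g).
Proof. by rewrite /nzinc /= -/(nzinc g) sg andbT; apply/allP => y _; rewrite leq0n orbT. Qed.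

Lemma underE_asc0 : asc (0 :: g) 0 = false.
Proof. by rewrite /asc /= gh ltnn andbF. Qed.

Lemma underE_rmin0 : rmin (0 :: g) 0 = false.
Proof. by rewrite /rmin /= drop0; case: (g) g0 gh => //= y t _ ->. Qed.

Lemma underE_pmax i : pmax (0 :: g) i.+1 = pmax g i.
Proof. by rewrite /pmax /= big_cons max0n. Qed.

(** The difference is 1 at the first position and at least 2 afterwards, since the prefix maximum of
    [g] at index [j] is at most [j]. *)
Lemma underE_expo0 : expo (0 :: g) 0.
Proof.
apply/expoP; split; first by rewrite /cov.
have -> : pmax (0 :: g) 0 = 0 by rewrite /pmax /= take0 big_cons big_nil.
by move=> [|j] //= _; rewrite underE_pmax; have := pmax_inv j ig; lia.
Qed.

(** Every difference grows by exactly 1, so comparisons are preserved. *)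
Lemma underE_expo i : i < size g -> expo (0 :: g) i.+1 = expo g i.
Proof.
move=> hi; have hc : cov (0 :: g) i.+1 = cov g i by [].
apply/expoP/expoP; rewrite hc underE_pmax => -[? h]; split=> //.
  move=> j /andP[ij jg]; have := h j.+1; rewrite underE_pmax /= !ltnS ij => /(_ jg).
  by have := pmax_inv i ig; have := pmax_inv j ig; lia.
move=> [|j] //; rewrite underE_pmax => /h.
by have := pmax_inv i ig; have := pmax_inv j ig; lia.
Qed.
End UnderInv.

(** * Permutations *)

Definition isp (w : seq nat) := uniq w /\ forall y, (y \in w) = (0 < y <= size w).

Lemma isp_uniq w : uniq w -> (forall y, y \in w -> 0 < y <= size w) -> isp w.
Proof.
move=> uw h; split=> // y.
have sub : {subset w <= iota 1 (size w)} by move=> z /h; rewrite mem_iota add1n.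
have [|_ ->] := uniq_min_size uw sub; first by rewrite size_iota.
by rewrite mem_iota add1n.
Qed.

Lemma is_permE n w : is_perm n w <-> isp w /\ size w = n.
Proof.
split=> [pw|[[uw mw] <-]].
  have sw : size w = n by rewrite (perm_size pw) size_iota.
  split=> //; split; first by rewrite (perm_uniq pw) iota_uniq.
  by move=> y; rewrite (perm_mem pw) mem_iota add1n sw.
by apply: uniq_perm => // [|y]; rewrite ?iota_uniq // mw mem_iota add1n.
Qed.

(* A single witness shape covers both 2413 ([i < j]) and 4213 ([j < i]). *)
Definition bad w := exists i j k l,
  [/\ i < k, j < k, k < l & l < size w] /\ nth 0 w k < nth 0 w i < nth 0 w l /\ nth 0 w l < nth 0 w j.

(** Values below [x] move up by one to free the value 1. Values above [x] move up by [k]: one for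
    the new 1, and [k - 1] because [x] is inflated to the block [x + 1, ..., x + k]. *)
Definition spread k x r := if r < x then r.+1 else r + k.
Definition glueP (L sg : seq nat) :=
  map (addn (head 0 sg)) L ++ 1 :: map (spread (size L) (head 0 sg)) (behead sg).

Section GluePerm.
Variables (L R : seq nat) (x : nat).
Let sg := x :: R.
Let u := map (addn x) L.
Let K := size u.
Let f := spread (size L) x.
Let p := glueP L sg.
Hypothesis (L0 : 0 < size L) (pL : isp L) (ps : isp sg).

Let pE : p = u ++ 1 :: map f R. Proof. by []. Qed.
Let KE : K = size L. Proof. exact: size_map. Qed.
Let K0 : 0 < K. Proof. by rewrite KE. Qed.
Let eqKj j : (K + j.+1 == K) = false. Proof. lia. Qed.
Let ltKj j : (K + j.+1 < K) = false. Proof. lia. Qed.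

Let pzone i : i < size p -> [\/ i < K, i = K | exists2 j, j < size R & i = K + j.+1].
Proof. by rewrite pE => /zoneP; rewrite size_map. Qed.

Let sizep : size p = K + (size R).+1. Proof. by rewrite pE size_cat /= size_map. Qed.

Let nth_u i : i < K -> nth 0 u i = x + nth 0 L i.
Proof. by rewrite KE => h; rewrite (nth_map 0). Qed.

Let nth_f j : j < size R -> nth 0 (map f R) j = f (nth 0 R j).
Proof. exact: nth_map. Qed.

Let x_gt0 : 0 < x <= (size R).+1.
Proof. by have := ps.2 x; rewrite inE eqxx => /esym. Qed.

Let R_bnd (r : nat) : r \in R -> r != x /\ 0 < r <= (size R).+1.
Proof.
move=> rR; case: ps => /= /andP[xR _] /(_ r); rewrite inE rR orbT => h; split=> //.
by apply: contraNneq xR => <-.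
Qed.

Let L_bnd (y : nat) : y \in L -> 0 < y <= K.
Proof. by case: pL => _ ->; rewrite KE. Qed.

Let u_bnd (y : nat) : y \in u -> x < y <= x + K.
Proof. by case/mapP=> z /L_bnd hz ->; lia. Qed.

Let u_x1 : x + 1 \in u.
Proof. by apply/mapP; exists 1 => //; case: pL => _ ->. Qed.

Let f_cases (r : nat) : r \in R -> (r < x /\ f r = r.+1) \/ (x < r /\ f r = r + K).
Proof. by move=> /R_bnd[]; rewrite /f /spread KE; case: (ltnP r x); lia. Qed.

Let f_lt (r s : nat) : r \in R -> s \in R -> (f r < f s) = (r < s).
Proof. by move=> /f_cases h1 /f_cases; lia. Qed.

Let f_gt1 (r : nat) : r \in R -> 1 < f r.
Proof. by move=> rR; have := f_cases rR; have := R_bnd rR; lia. Qed.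

Let f_inj : {in R &, injective f}.
Proof. by move=> r s /f_cases h1 /f_cases; lia. Qed.

Lemma glueP_isp : isp p.
Proof.
apply: isp_uniq; last first.
  move=> y; rewrite sizep pE mem_cat inE => /or3P[/u_bnd|/eqP->|/mapP[r rR ->]]; try lia.
  by have := f_cases rR; have := R_bnd rR; lia.
case: pL ps => uL _ [/= /andP[xR uR] _].
rewrite pE cat_uniq /= map_inj_uniq ?uL; last exact: addnI.
rewrite map_inj_in_uniq // uR andbT negb_or /= -andbA; apply/and3P; split.
- by apply/negP => h; have := u_bnd (h : 1 \in u); lia.
- apply/hasPn => _ /mapP[r rR ->]; apply/negP => h; move: (h : f r \in u) => /u_bnd.
  by have := f_cases rR; lia.
- by apply/mapP => -[r /f_gt1]; lia.
Qed.

(** The letters before 1 fill an interval, so no later value separates two of them. An occurrence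
    ending after the block therefore uses at most one block letter, which collapses to [x]; any
    other occurrence lies inside the block. *)
Lemma glueP_bad : bad p <-> bad L \/ bad sg.
Proof.
have inL i : i < K -> 0 < nth 0 L i <= K by move=> h; apply: L_bnd; rewrite mem_nth // -KE.
have vL i : i < K -> nth 0 p i = x + nth 0 L i.
  by move=> h; rewrite pE nth_zoneL // nth_u.
have vM : nth 0 p K = 1 by rewrite pE nth_zoneM.
have vR j : j < size R -> nth 0 p (K + j.+1) = f (nth 0 R j).
  by move=> h; rewrite pE nth_zoneR nth_f.
have fR j : j < size R -> (nth 0 R j < x /\ f (nth 0 R j) = (nth 0 R j).+1) \/
                          (x < nth 0 R j /\ f (nth 0 R j) = nth 0 R j + K).
  by move=> h; apply/f_cases/mem_nthn.
have fR1 j : j < size R -> 1 < f (nth 0 R j) by move=> h; apply/f_gt1/mem_nthn.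
split=> [|[]].
- move=> [i [j [k [l [[ik jk kl lp] [v1 v2]]]]]].
  have zl := pzone lp.
  have zk := pzone (ltn_trans kl lp).
  have zi := pzone (ltn_trans (ltn_trans ik kl) lp).
  have zj := pzone (ltn_trans (ltn_trans jk kl) lp).
  have {}zl : l < K \/ exists2 l', l' < size R & l = K + l'.+1.
    case: zl; auto => lE; exfalso; move: v1 v2; rewrite lE vM; lia.
  case: zl => [lK|[l' hl lE]].
    left; exists i, j, k, l; split; first by split=> //; rewrite -KE.
    by move: v1 v2; rewrite !vL; lia.
  right; case: zk => [kK|kE|[k' hk kE]].
  (* With [k] in the block or at the pivot, [i] and [j] are both in the block and the value at [l]
     would fall strictly between two block values. *)
  + exfalso; move: v1 v2; rewrite lE vR // !vL; try lia.
    have := fR _ hl; have := inL i; have := inL j; have := inL k; lia.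
  + exfalso; move: v1 v2; rewrite lE vR // kE vM !vL; try lia.
    have := fR _ hl; have := inL i; have := inL j; lia.
  have {}zi : i < K \/ exists2 l', l' < size R & i = K + l'.+1.
    case: zi; auto => iE; exfalso; move: v1 v2; rewrite iE vM kE vR //.
    have := fR1 _ hk; lia.
  have {}zj : j < K \/ exists2 l', l' < size R & j = K + l'.+1.
    case: zj; auto => jE; exfalso; move: v1 v2; rewrite jE vM lE vR //.
    have := fR1 _ hl; lia.
  move: v1 v2; rewrite lE kE !vR //.
  case: zi => [iK|[i' hi iE]]; case: zj => [jK|[j' hj jE]].
  + rewrite !vL //; have := fR _ hl; have := inL i; have := inL j; lia.
  + rewrite jE vR // vL // => v1 v2; exists 0, j'.+1, k'.+1, l'.+1; split.
      by split; rewrite //= ?ltnS //; lia.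
    rewrite /=; have := fR _ hl; have := fR _ hk; have := fR _ hj; have := inL i; lia.
  + rewrite iE vR // vL // => v1 v2; exists i'.+1, 0, k'.+1, l'.+1; split.
      by split; rewrite //= ?ltnS //; lia.
    rewrite /=; have := fR _ hl; have := fR _ hk; have := fR _ hi; have := inL j; lia.
  + rewrite jE iE !vR // => v1 v2; exists i'.+1, j'.+1, k'.+1, l'.+1; split.
      by split; rewrite //= ?ltnS //; lia.
    rewrite /=; have := fR _ hl; have := fR _ hk; have := fR _ hi; have := fR _ hj; lia.
- move=> [i [j [k [l [[ik jk kl lp] v]]]]]; exists i, j, k, l; rewrite sizep KE.
  by split; [split | rewrite !vL]; lia.
- move=> [i [j [k [l [[ik jk kl lp] v]]]]].
  (* [t] carries indices of [sg] to indices of [p]; the first letter of the block represents the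
     collapsed letter. *)
  pose t m := if m is m'.+1 then K + m'.+1 else 0.
  have vt m : m < size sg -> nth 0 p (t m) = if m is m'.+1 then f (nth 0 R m') else x + nth 0 L 0.
    by case: m => [|m] //= hm; [rewrite vL | rewrite vR].
  exists (t i), (t j), (t k), (t l); split.
    have tlt a b : a < b -> t a < t b by rewrite /t; case: a b => [|a] [|b]; lia.
    split; try exact: tlt; rewrite sizep /t; case: (l) lp kl => [|l'] /=; lia.
  move: (lp) v; rewrite !vt; try lia.
  case: (k) ik jk kl => // k' ik jk; case: (l) => // l' kl; move=> hl; have {}hl : l' < size R by [].
  have hk : k' < size R by lia.
  have := inL 0 K0; have := fR _ hl; have := fR _ hk.
  case: (i) ik => [|i'] ik; case: (j) jk => [|j'] jk /=; try lia.
  + have := fR j'; lia.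
  + have := fR i'; lia.
  + have := fR i'; have := fR j'; lia.
Qed.

Lemma glueP_desc i : i < size p ->
  desc p i = if i < K then (i.+1 == K) || desc L i else (K < i) && desc sg (i - K).
Proof.
case/pzone=> [h|->|[j h ->]]; rewrite /desc sizep pE.
- rewrite h (nth_zoneL 1 (map f R) h); case: (i.+1 =P K) => [->|ne].
    rewrite nth_zoneM (_ : 1 < nth 0 u i) ?andbT; first lia.
    by have := u_bnd (mem_nthn h); lia.
  rewrite nth_zoneL -/K; last lia.
  rewrite !nth_u; lia.
- rewrite ltnn /= nth_zoneM; have := nth_zoneR u 1 (map f R) 0; rewrite addn1 => ->.
  case: (posnP (size R)) => h; first lia.
  by rewrite nth_f //; have := f_gt1 (mem_nthn h); lia.
- rewrite ltKj -addnS !nth_zoneR addKn /= !ltnS ltn_add2l ltnS.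
  rewrite (_ : K < K + j.+1); last lia.
  by case: (ltnP j.+1 (size R)) => // h2; rewrite /= !nth_f // f_lt ?mem_nthn.
Qed.

(** The least block value is [x + 1]. Hence 2 precedes the pivot exactly when [x = 1], and a later
    letter coming from [r] has its successor in the block exactly when [r + 1 = x]. *)
Lemma glueP_vid i : i < size p ->
  vid p i = if i < K then vid L i else if i == K then x == 1 else vid sg (i - K).
Proof.
case/pzone=> [h|->|[j h ->]]; rewrite /vid pE.
- rewrite h nth_zoneL // take_zoneL // nth_u // -map_take -addnS mem_map //; exact: addnI.
- rewrite ltnn eqxx nth_zoneM take_zoneM; apply/idP/eqP => [/u_bnd|x1]; first lia.
  by have := u_x1; rewrite {1}x1.
- rewrite ltKj eqKj nth_zoneR take_zoneR nth_f // addKn /= mem_cat !inE -map_take.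
  set r := nth 0 R j; have rR : r \in R by apply: mem_nthn.
  have c1 := f_cases rR; have b1 := R_bnd rR.
  have -> : ((f r).+1 \in u) = (r.+1 == x).
    apply/idP/eqP => [/u_bnd|rx]; first lia.
    by have -> : (f r).+1 = x + 1 by lia.
  rewrite (_ : (f r).+1 == 1 = false); last lia.
  rewrite orFb; case: eqP => //= rx.
  apply/mapP/idP => [[s st]|st].
    by have := f_cases (mem_take st) => c2 E; have <- : s = r.+1 by lia.
  by exists r.+1 => //; have := f_cases (mem_take st); lia.
Qed.

(** For a letter after the pivot, exceeding the whole block is the same as exceeding [x] before
    inflation. *)
Lemma glueP_lmax i : i < size p ->
  lmax p i = if i < K then lmax L i else (K < i) && lmax sg (i - K).
Proof.
case/pzone=> [h|->|[j h ->]]; rewrite /lmax pE.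
- rewrite h nth_zoneL // take_zoneL // nth_u // -map_take all_map.
  by apply: eq_all => y /=; rewrite ltn_add2l.
- rewrite ltnn nth_zoneM take_zoneM.
  by apply/allP => /(_ _ u_x1); lia.
- rewrite ltKj nth_zoneR take_zoneR nth_f // addKn /= all_cat /= -map_take all_map.
  rewrite (_ : K < K + j.+1); last lia.
  set r := nth 0 R j; have rR : r \in R by apply: mem_nthn.
  rewrite f_gt1 //=; congr (_ && _); last first.
    by apply: eq_in_all => s /mem_take sR /=; rewrite f_lt.
  have c1 := f_cases rR; apply/allP/idP => [h1|xr y /u_bnd]; last lia.
  by have := h1 _ u_x1; lia.
Qed.

Lemma glueP_lmin i : i < size p ->
  lmin p i = if i < K then lmin L i else i == K.
Proof.
case/pzone=> [h|->|[j h ->]]; rewrite /lmin pE.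
- rewrite h nth_zoneL // take_zoneL // nth_u // -map_take all_map.
  by apply: eq_all => y /=; rewrite ltn_add2l.
- rewrite ltnn eqxx nth_zoneM take_zoneM; apply/allP => y /u_bnd; lia.
- rewrite ltKj eqKj nth_zoneR take_zoneR nth_f // all_cat /=.
  by have := f_gt1 (mem_nthn h); lia.
Qed.

Lemma glueP_rmax i : i < size p ->
  rmax p i = if i < K then rmax L i && rmax sg 0
             else if i == K then size R == 0 else rmax sg (i - K).
Proof.
case/pzone=> [h|->|[j h ->]]; rewrite /rmax pE.
- rewrite h nth_zoneL // drop_zoneL // all_cat nth_u // -map_drop !all_map /= drop0.
  have hL := L_bnd (mem_nthn (etrans (f_equal _ (esym KE)) h : i < size L)).
  congr (_ && _); first by apply: eq_all => y /=; rewrite ltn_add2l.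
  rewrite (_ : 1 < _) /=; last lia.
  by rewrite all_map; apply: eq_in_all => s /f_cases /=; lia.
- rewrite ltnn eqxx nth_zoneM drop_zoneM all_map.
  case: (R) f_gt1 => //= y t /(_ y); rewrite inE eqxx => /(_ isT); lia.
- rewrite ltKj eqKj nth_zoneR drop_zoneR nth_f // addKn /= -map_drop all_map.
  by apply: eq_in_all => s /mem_drop sR /=; rewrite f_lt // mem_nthn.
Qed.

Lemma glueP_rmin i : i < size p ->
  rmin p i = if i < K then false else (i == K) || rmin sg (i - K).
Proof.
case/pzone=> [h|->|[j h ->]]; rewrite /rmin pE.
- rewrite h nth_zoneL // drop_zoneL // all_cat /=.
  by have := u_bnd (mem_nthn h); lia.
- rewrite ltnn eqxx nth_zoneM drop_zoneM; apply/allP => _ /mapP[s /f_gt1 ? ->] //.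
- rewrite ltKj eqKj nth_zoneR drop_zoneR nth_f // addKn /= -map_drop all_map.
  by apply: eq_in_all => s /mem_drop sR /=; rewrite f_lt // mem_nthn.
Qed.
End GluePerm.

(** * Trees *)

Inductive tree := Leaf | Under of tree | Glue of tree & tree.

Fixpoint weight t :=
  match t with Leaf => 1 | Under t => (weight t).+1 | Glue a b => weight a + weight b end.

Definition isG t := if t is Glue _ _ then true else false.

Definition firstnz (g : seq nat) := head 0 [seq z <- g | z != 0].

Fixpoint enc t :=
  match t with
  | Leaf => [:: 0]
  | Under t => 0 :: enc t
  | Glue a b => glueE (enc a) (enc b) (if isG b then firstnz (enc b) else 0)
  end.
(** The conditional written out inside [enc], which the proofs fold back to [shift b]. *)
Definition shift t := if isG t then firstnz (enc t) else 0.

Fixpoint dec t :=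
  match t with
  | Leaf => [:: 1]
  | Under t => 1 :: map succn (dec t)
  | Glue a b => glueP (dec a) (dec b)
  end.

Lemma weight_gt0 t : 0 < weight t.
Proof. by elim: t => //= a ha b _; rewrite addn_gt0 ha. Qed.

Lemma firstnzP g : nzinc g -> has (predC1 0) g ->
  [/\ firstnz g \in g, firstnz g != 0 & forall z, z \in g -> z != 0 -> firstnz g <= z].
Proof.
rewrite /firstnz; elim: g => //= y g IH /andP[hy sg]; have [->|ny] := eqVneq y 0.
  move=> /= /(IH sg)[h1 h2 h3]; split=> //; first by rewrite inE h1 orbT.
  by move=> z; rewrite inE => /orP[/eqP->//|]; apply: h3.
move=> _ /=; split; rewrite ?inE ?eqxx // => z; rewrite inE => /orP[/eqP->//|zg nz].
by have /orP[/eqP z0|//] := allP hy _ zg; rewrite z0 in nz.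
Qed.

Definition touches g := exists2 j, 0 < j < size g & nth 0 g j = j.

(** Bundles [c_le], [c_gt] and [c_touch]. *)
Record shift_of (s : seq nat) c : Prop := ShiftOf {
  shift_le : forall z, z \in s -> z != 0 -> c <= z;
  shift_gt : forall j, j < size s -> nth 0 s j < j.+1 + c;
  shift_touch : 0 < c -> c \in s /\ exists2 t, t < size s & nth 0 s t = t.+1 }.

(** The pivot of a [Glue] is a maximal entry after the first, whereas prepending 0 pushes all old
    entries strictly below the diagonal. So shift 0 respects [shift_gt] for the other trees; for a
    [Glue] the shift is the least nonzero entry, and being positive it leaves the required room. *)
Lemma enc_spec t :
  [/\ size (enc t) = weight t, invs (enc t), nzinc (enc t),
      isG t <-> touches (enc t) & shift_of (behead (enc t)) (shift t)].
Proof.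
elim: t => [|t [st it nt _ _]|a [sa ia na _ _] b [sb ib nb gb [b1 b2 b3]]].
- split; [by [] | by case | by [] | by split=> // -[[|[]]] | by split].
- have t0 : 0 < size (enc t) by rewrite st weight_gt0.
  split; [by rewrite /= st | exact: underE_invs | exact: underE_nzinc | |].
    split=> // -[[|j] //= /ltnSE hj ej].
    by have := it _ hj; rewrite ej ltnn.
  split=> //= j /it; rewrite /shift /=; lia.
- have a0 : 0 < size (enc a) by rewrite sa weight_gt0.
  have b0 : 0 < size (enc b) by rewrite sb weight_gt0.
  have [s bE] : exists s, enc b = 0 :: s.
    case: (enc b) b0 ib => // y s _ /(_ 0 isT) /=; rewrite leqn0 => /eqP->; by exists s.
  rewrite bE /= in ib nb b1 b2 b3 sb.
  have iG : invs (enc (Glue a b)) by rewrite /= -/(shift b) bE; apply: glueE_invs.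
  have nG : nzinc (enc (Glue a b)) by rewrite /= -/(shift b) bE; apply: glueE_nzinc.
  have sG : size (enc (Glue a b)) = weight (Glue a b).
    by rewrite /= /glueE bE size_cat /= size_map sa -sb.
  have tG : touches (enc (Glue a b)).
    exists (size (enc a)); first by rewrite sG a0 sa /= -sb; lia.
    by rewrite /= /glueE nth_zoneM.
  split=> //.
  have hasnz : has (predC1 0) (enc (Glue a b)).
    by apply/hasP; exists (size (enc a)); [rewrite /= mem_cat inE eqxx orbT | rewrite /=; lia].
  have [h1 h2 h3] := firstnzP nG hasnz.
  have [s' GE] : exists s', enc (Glue a b) = 0 :: s'.
    case: (enc (Glue a b)) hasnz iG => // y t _ /(_ 0 isT) /=; rewrite leqn0 => /eqP->.
    by exists t.
  rewrite /shift [isG _]/= GE in h1 h2 h3 iG tG *; split=> /=.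
  + by move=> z zs; apply: h3; rewrite inE zs orbT.
  + move=> j hj; have := iG j.+1 hj; rewrite /=; lia.
  + move=> _; split; first by move: h1; rewrite inE (negbTE h2).
    by case: tG => -[|j] //= hj ej; exists j.
Qed.

Lemma enc_cons t : exists s, enc t = 0 :: s.
Proof.
have [st it _ _ _] := enc_spec t; case: (enc t) st it (weight_gt0 t) => [<-//|y s _].
by move=> /(_ 0 isT) /=; rewrite leqn0 => /eqP-> _; exists s.
Qed.

Lemma shift_eq0 t : (shift t == 0) = ~~ isG t.
Proof.
rewrite /shift; have [_ it nt gt _] := enc_spec t; case: (boolP (isG t)) => // /gt[j hj ej].
have [|_ h _] := firstnzP nt; last exact: negbTE.
by apply/hasP; exists j; [rewrite -{1}ej mem_nth; case/andP: hj | rewrite /=; lia].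
Qed.

Lemma under_isp w : isp w -> isp (1 :: map succn w).
Proof.
move=> [uw mw]; apply: isp_uniq => /=.
  rewrite map_inj_uniq ?uw ?andbT; last exact: succn_inj.
  by apply/mapP => -[y]; rewrite mw; lia.
by move=> y; rewrite inE size_map => /orP[/eqP->|/mapP[z]] //; rewrite mw; lia.
Qed.

Lemma under_bad w : bad (1 :: map succn w) <-> bad w.
Proof.
have vS m : m < size w -> nth 0 (map succn w) m = (nth 0 w m).+1.
  by move=> hm; rewrite (nth_map 0).
split.
  move=> [i [j [k [l [[]]]]]]; rewrite /= size_map ltnS.
  case: i j k l => [|i] [|j] [|k] [|l] //= ik jk kl lw; rewrite !vS; try lia.
  by move=> h; exists i, j, k, l; split; [split|lia].
move=> [i [j [k [l [[ik jk kl lw] h]]]]]; exists i.+1, j.+1, k.+1, l.+1.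
by split; [split; rewrite //= size_map | rewrite /= !vS; lia].
Qed.

(** A [Glue] begins with [x] plus a positive letter, hence with a letter above 1; the other trees
    begin with 1. *)
Lemma dec_spec t :
  [/\ size (dec t) = weight t, isp (dec t), ~ bad (dec t) & (head 0 (dec t) == 1) = ~~ isG t].
Proof.
elim: t => [|t [st pt bt _]|a [sa pa ba ha] b [sb pb bb hb]].
- split=> //; first by apply: isp_uniq => // y; rewrite inE => /eqP->.
  by move=> [i [j [k [l [[ik jk kl]]]]]]; rewrite /=; lia.
- by split; rewrite //= ?size_map ?st //; [exact: under_isp | rewrite under_bad].
- have a0 : 0 < size (dec a) by rewrite sa weight_gt0.
  have : 0 < size (dec b) by rewrite sb weight_gt0.
  case E : (dec b) pb bb sb hb => [//|x R] pb bb sb hb _; rewrite /= E.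
  split; first by rewrite /glueP size_cat /= !size_map sa -sb.
  + exact: glueP_isp.
  + by rewrite glueP_bad // => -[].
  + have x0 : 0 < x by have := pb.2 x; rewrite inE eqxx; lia.
    case: (dec a) a0 pa => // y L _ [_ /(_ y)]; rewrite inE eqxx /glueP /=; lia.
Qed.

(** The recursions match zone by zone. At the pivot, [shift b = 0] and [x = 1] both say that [b] is
    not a [Glue]. Before the pivot, [rmin] and [rmax] also call on position 0 of the second word,
    covered by the induction hypothesis for [b]. *)
Lemma tree_stat t i : i < weight t ->
  [/\ dist (enc t) i = vid (dec t) i, asc (enc t) i = desc (dec t) i
    & (nth 0 (enc t) i == 0) = lmax (dec t) i] /\
  [/\ (nth 0 (enc t) i == i) = lmin (dec t) i, rmin (enc t) i = rmax (dec t) i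
    & expo (enc t) i = rmin (dec t) i].
Proof.
elim: t i => [|t IH|a IHa b IHb] i.
- case: i => // _; do 2!split=> //.
  by apply/expoP; split=> // -[|j].
- have [se ie ne _ _] := enc_spec t; have [sp [_ mp] _ _] := dec_spec t.
  have t0 : 0 < size (enc t) by rewrite se weight_gt0.
  have d0 : 0 < size (dec t) by rewrite sp weight_gt0.
  have dS m : m < size (dec t) -> nth 0 (map succn (dec t)) m = (nth 0 (dec t) m).+1.
    by move=> hm; rewrite (nth_map 0).
  have dpos y : y \in dec t -> 0 < y by rewrite mp; lia.
  case: i => [|i]; rewrite [weight _]/= ?ltnS => hi.
    do 2!split=> //.
    + by rewrite underE_asc0 // /desc /= dS //; lia.
    + rewrite underE_rmin0 // /rmax /= drop0.
      by case: (dec t) d0 dpos => //= y w _ /(_ y); rewrite inE eqxx => /(_ isT); lia.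
    + rewrite underE_expo0 //; apply/esym/allP => y; rewrite /= drop0.
      by case/mapP => z /dpos ? ->.
  have [[h1 h2 h3] [h4 h5 h6]] := IH i hi.
  have hd : i < size (dec t) by rewrite sp.
  have di := dpos _ (mem_nthn hd).
  do 2!split.
  + rewrite [LHS]h1 /vid /= dS // inE -map_take mem_map; last exact: succn_inj.
    by case: eqP => //; lia.
  + have -> : asc (enc (Under t)) i.+1 = asc (enc t) i by [].
    rewrite h2 /desc /= size_map ltnS; case: ltnP => // hi2; rewrite !dS //.
  + rewrite [LHS]h3 /lmax /= dS // -map_take all_map ltnS di.
    by apply: eq_all.
  + by rewrite /lmin /= dS // [LHS]ltn_eqF // ltnS ie // se.
  + by rewrite [LHS]h5 /rmax /= dS // -map_drop all_map; apply: eq_all.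
  + rewrite underE_expo // ?se // h6 /rmin /= dS // -map_drop all_map; exact: eq_all.
- have [sa ia na _ _] := enc_spec a; have [sb ib nb gb [b1 b2 b3]] := enc_spec b.
  have [qa pa _ _] := dec_spec a; have [qb pb _ hb] := dec_spec b.
  have [s bE] := enc_cons b; have e0 := shift_eq0 b.
  have a0 : 0 < size (enc a) by rewrite sa weight_gt0.
  have d0 : 0 < size (dec a) by rewrite qa weight_gt0.
  case dE : (dec b) qb pb hb => [|x R] qb pb hb; first by have := weight_gt0 b; rewrite -qb.
  rewrite bE [head _ _]/= in ib nb b1 b2 b3 sb hb.
  rewrite bE dE in IHb.
  have encE : enc (Glue a b) = glueE (enc a) (0 :: s) (shift b) by rewrite -bE.
  have decE : dec (Glue a b) = glueP (dec a) (x :: R) by rewrite -dE.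
  have [sE _ _ _ _] := enc_spec (Glue a b); have [sP _ _ _] := dec_spec (Glue a b).
  rewrite encE in sE; rewrite decE in sP; rewrite encE decE => hi.
  have hE := hi; have hP := hi; rewrite -sE in hE; rewrite -sP in hP.
  have sR : size s = size R by move: sb qb => /= <- [].
  have [_ [_ b0 _]] := IHb 0 (weight_gt0 b).
  do 2!split.
  + rewrite glueE_dist // glueP_vid // size_map sa qa e0 -hb.
    case: ltnP => [/IHa[[]]//|ai]; case: eqP => // ne.
    by have [|[-> _ _] _] := IHb (i - weight a); first by move: hi ne => /=; lia.
  + rewrite glueE_asc // glueP_desc // size_map sa qa.
    case: ltnP => [/IHa[[_ -> _]]//|ai].
    by have [|[_ -> _] _] := IHb (i - weight a); first by move: hi (weight_gt0 a) => /=; lia.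
  + rewrite glueE_zero // glueP_lmax // size_map sa qa.
    case: ltnP => [/IHa[[_ _ ->]]//|ai].
    by have [|[_ _ ->] _] := IHb (i - weight a); first by move: hi (weight_gt0 a) => /=; lia.
  + rewrite glueE_ema // glueP_lmin // size_map sa qa.
    by case: ltnP => [/IHa[_ []]|ai].
  + rewrite glueE_rmin // glueP_rmax // size_map sa qa b0 sR.
    case: ltnP => [/IHa[_ [_ ->]]//|ai]; case: eqP => // ne.
    by have [|_ [_ -> _]] := IHb (i - weight a); first by move: hi ne => /=; lia.
  + rewrite glueE_expo // glueP_rmin // size_map sa qa.
    case: ltnP => // ai.
    by have [|_ [_ _ ->]] := IHb (i - weight a); first by move: hi (weight_gt0 a) => /=; lia.
Qed.

(** * Bijectivity *)

(** The pivot is the last maximal entry, so the word determines its place. *)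
Lemma glueE_pivot P s c P' s' c' : 0 < size P -> 0 < size P' ->
  invs P -> invs P' -> nzinc P -> nzinc P' -> nzinc (0 :: s) -> nzinc (0 :: s') ->
  shift_of s c -> shift_of s' c' ->
  glueE P (0 :: s) c = glueE P' (0 :: s') c' -> size P = size P'.
Proof.
move=> k0 k0' iP iP' nP nP' ns ns' [c1 c2 c3] [c1' c2' c3'] E.
have sz Q t d : size (glueE Q (0 :: t) d) = size Q + (size t).+1.
  by rewrite size_cat /= size_map.
have h1 : (nth 0 (glueE P (0 :: s) c) (size P) == size P) by rewrite nth_zoneM.
have h2 : (nth 0 (glueE P (0 :: s) c) (size P') == size P') by rewrite E nth_zoneM.
have l1 : size P < size (glueE P' (0 :: s') c') by rewrite -E sz; lia.
have l2 : size P' < size (glueE P (0 :: s) c) by rewrite E sz; lia.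
move: h1 h2; rewrite [in X in X -> _]E !glueE_ema //.
case: (ltngtP (size P) (size P')) => //; lia.
Qed.

(** Suppose [c < c']. Then [c'] occurs in [s'] and maps to [k], so [s] has the nonzero entry [c]
    there and [c > 0]. Hence [s] has an entry [t.+1] at index [t], and the corresponding entry of
    [s'] is larger by [c' - c], above the diagonal. *)
Lemma shift_le_of k s c s' c' : 0 < k -> shift_of s c -> shift_of s' c' -> invs (0 :: s') ->
  map (raise k c) s = map (raise k c') s' -> c' <= c.
Proof.
move=> k0 [c1 c2 c3] [c1' c2' c3'] i' E; rewrite leqNgt; apply/negP => cc.
have ss : size s = size s' by rewrite -(size_map (raise k c) s) E size_map.
have nthE j : j < size s -> raise k c (nth 0 s j) = raise k c' (nth 0 s' j).
  by move=> hj; rewrite -(nth_map 0 0) // E (nth_map 0) // -ss.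
have [/nthnP[j hj ej] _] := c3' (leq_ltn_trans (leq0n c) cc).
have c0 : 0 < c.
  rewrite -ss in hj; have := nthE j hj; have := c1 _ (mem_nthn hj).
  rewrite ej /raise; case: eqP; case: eqP; lia.
have [_ [t ht et]] := c3 c0.
have := nthE t ht; have := i' t.+1; rewrite /= ltnS -ss => /(_ ht).
have ht' : t < size s' by rewrite -ss.
by have := c1' _ (mem_nthn ht'); rewrite et /raise /=; case: eqP; lia.
Qed.

Lemma enc_inj : injective enc.
Proof.
(* A maximal entry after the first separates [Glue] from the other constructors; length separates
   [Leaf] from [Under]. *)
have UG t a b : enc (Under t) <> enc (Glue a b).
  move=> E; have [_ _ _ [_ h] _] := enc_spec (Under t); have [_ _ _ [h' _] _] := enc_spec (Glue a b).
  by have := h; rewrite E => /(_ (h' isT)).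
have LG a b : enc Leaf <> enc (Glue a b).
  move=> E; have [_ _ _ [_ h] _] := enc_spec Leaf; have [_ _ _ [h' _] _] := enc_spec (Glue a b).
  by have := h; rewrite E => /(_ (h' isT)).
have LU t : enc Leaf <> enc (Under t).
  by move=> [] E; have [h _ _ _ _] := enc_spec t; have := weight_gt0 t; rewrite -h -E.
elim=> [|t IH|a IHa b IHb] [|t'|a' b'] //.
- by move/LU.
- by move/LG.
- by move/esym/LU.
- by case=> /IH ->.
- by move/UG.
- by move/esym/LG.
- by move/esym/UG.
have [sa ia na _ _] := enc_spec a; have [sb ib nb _ sh] := enc_spec b.
have [sa' ia' na' _ _] := enc_spec a'; have [sb' ib' nb' _ sh'] := enc_spec b'.
have a0 : 0 < size (enc a) by rewrite sa weight_gt0.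
have a0' : 0 < size (enc a') by rewrite sa' weight_gt0.
have [s bE] := enc_cons b; have [s' bE'] := enc_cons b'.
rewrite bE [behead _]/= in ib nb sh; rewrite bE' [behead _]/= in ib' nb' sh'.
rewrite /= -/(shift b) -/(shift b') bE bE' => E.
have kk := glueE_pivot a0 a0' ia ia' na na' nb nb' sh sh' E.
move: E => /eqP; rewrite /glueE eqseq_cat //= eqseq_cons => /and3P[/eqP /IHa <- _ /eqP E].
have cc : shift b = shift b'.
  apply/eqP; rewrite eqn_leq (shift_le_of a0 sh' sh ib (esym E)).
  by rewrite (shift_le_of a0 sh sh' ib' E).
have ss : s = s'.
  have szs : size s = size s' by have := f_equal size E; rewrite !size_map.
  apply: (@eq_from_nth _ 0) => // j hj; have hj' := hj; rewrite szs in hj'.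
  have := f_equal (fun w => nth 0 w j) E; rewrite /= !(nth_map 0) // -cc.
  case: sh sh' => [c1 _ _] [c1' _ _]; have := c1 _ (mem_nthn hj); have := c1' _ (mem_nthn hj').
  rewrite -cc /raise; case: eqP; case: eqP; lia.
by congr Glue; apply: IHb; rewrite bE bE' ss.
Qed.

Lemma spread_inj k x r s : 0 < k -> r != x -> s != x -> spread k x r = spread k x s -> r = s.
Proof. by rewrite /spread; case: (ltnP r x); case: (ltnP s x); lia. Qed.

Lemma dec_inj : injective dec.
Proof.
have UL t : dec (Under t) <> dec Leaf.
  by move=> [] E; have [h _ _ _] := dec_spec t; have := weight_gt0 t; rewrite -h;
    move/(f_equal size): E; rewrite size_map /= => ->.
have NG t a b : dec t = dec (Glue a b) -> isG t.
  move=> E; have [_ _ _] := dec_spec t; have [_ _ _] := dec_spec (Glue a b).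
  by rewrite E => -> /esym/negbFE.
elim=> [|t IH|a IHa b IHb] [|t'|a' b'] //; try by [move/NG | move/esym/NG | move/UL | move/esym/UL].
  by case=> /(inj_map succn_inj)/IH ->.
have [sa pa _ _] := dec_spec a; have [sb pb _ _] := dec_spec b.
have [sa' pa' _ _] := dec_spec a'; have [sb' pb' _ _] := dec_spec b'.
have := weight_gt0 b; have := weight_gt0 b'; have := weight_gt0 a; have := weight_gt0 a'.
rewrite -sa -sb -sa' -sb' => a0' a0 b0' b0.
rewrite [dec (Glue _ _)]/= [dec (Glue a' b')]/=.
case bE : (dec b) pb b0 => [//|x R] pb _; case bE' : (dec b') pb' b0' => [//|x' R'] pb' _.
rewrite /glueP /=; set u := map _ _; set u' := map _ (dec a').
have pos y : y \in u -> x < y.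
  by case/mapP => z; rewrite pa.2 => hz ->; lia.
have pos' y : y \in u' -> x' < y.
  by case/mapP => z; rewrite pa'.2 => hz ->; lia.
have x0 : 0 < x by have := pb.2 x; rewrite inE eqxx; lia.
have x0' : 0 < x' by have := pb'.2 x'; rewrite inE eqxx; lia.
have xu : x + 1 \in u by apply/map_f; rewrite pa.2.
have xu' : x' + 1 \in u' by apply/map_f; rewrite pa'.2.
move=> E.
(* The block ends where the letter 1 stands. *)
have kk : size u = size u'.
  have idx w v : (forall y, y \in w -> 1 < y) -> index 1 (w ++ 1 :: v) = size w.
    move=> h; rewrite index_cat ifN /= ?addn0 //; by apply/negP => /h.
  rewrite -(idx u (map (spread (size (dec a)) x) R)) => [|y /pos]; last lia.
  rewrite E idx // => y /pos'; lia.
move: E => /eqP; rewrite eqseq_cat // /= eqseq_cons => /and3P[/eqP E1 _ /eqP E2].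
(* [x + 1] is the least letter of the block, so the block determines [x]. *)
have xx : x = x'.
  have := pos' (x + 1); have := pos (x' + 1); rewrite -E1 in xu' *; move=> /(_ xu') + /(_ xu); lia.
have aa : a = a' by apply: IHa; apply: (inj_map (@addnI x)); rewrite -/u E1 xx.
subst a' x'; congr Glue; apply: IHb; rewrite bE bE'; congr cons.
have szs : size R = size R' by have := f_equal size E2; rewrite !size_map.
apply: (@eq_from_nth _ 0) => // j hj; have hj' := hj; rewrite szs in hj'.
have := f_equal (fun w => nth 0 w j) E2; rewrite /= !(nth_map 0) //.
have nx (T : seq nat) : isp (x :: T) -> forall y, y \in T -> y != x.
  by move=> [/andP[xT _] _] y yT; apply: contraNneq xT => <-.
by apply: spread_inj => //; [apply: nx pb _ _ | apply: nx pb' _ _]; apply: mem_nthn.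
Qed.

(** * Decomposition of an arbitrary word of each class *)

Definition unshift k c z := if z == 0 then 0 else z - k + c.

(** Recognises the shift of a tree known only through its word: a positive [c] in [s] that bounds
    the nonzero entries from below is the least of them, as is [shift t]. *)
Lemma enc_shift t s c : enc t = 0 :: s -> (forall z, z \in s -> z != 0 -> c <= z) ->
  (0 < c -> c \in s /\ touches (0 :: s)) -> (touches (0 :: s) -> 0 < c) -> shift t = c.
Proof.
move=> E cle cpos ct; have [_ _ nt gt [h1 h2 h3]] := enc_spec t.
rewrite E [behead _]/= in nt gt h1 h2 h3.
have [c0|c0] := posnP c.
  by apply/eqP; rewrite c0 shift_eq0; apply/negP => /gt/ct; rewrite c0.
have [cs tc] := cpos c0.
have sh0 : 0 < shift t by rewrite lt0n shift_eq0 negbK; apply/gt.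
have [ss _] := h3 sh0.
by apply/eqP; rewrite eqn_leq h1 // -?lt0n // cle // -lt0n.
Qed.

Lemma enc_surj e : 0 < size e -> invs e -> nzinc e -> exists t, enc t = e.
Proof.
have [n] := ubnP (size e); elim: n e => // n IH e en e0 ie ne.
(* [Q] marks the maximal entries after the first. The largest such index becomes the pivot; if there
   is none, the word comes from [Leaf] or [Under]. *)
pose Q i := (0 < i < size e) && (nth 0 e i == i).
have [/hasP[i0]|/hasPn noQ] := boolP (has Q (iota 0 (size e))); last first.
  have {}noQ j : 0 < j < size e -> nth 0 e j < j.
    move=> hj; have := noQ j; rewrite mem_iota /Q; have := ie j; lia.
  clear Q; case: e => [//|y g] in en e0 ie ne noQ *.
  have y0 : y = 0 by have := ie 0 isT; rewrite /= leqn0 => /eqP.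
  subst y; case: g => [|y g] in en e0 ie ne noQ *; first by exists Leaf.
  have [t tE] : exists t, enc t = y :: g; last by exists (Under t); rewrite /= tE.
  apply: IH => //; last by move: ne; rewrite /nzinc /= => /andP[].
  by move=> j hj; have := noQ j.+1 hj.
rewrite mem_iota => _ Qi0.
have exQ : exists i, Q i by exists i0.
have ubQ i : Q i -> i <= size e by rewrite /Q; lia.
case: (ex_maxnP exQ ubQ) => K /andP[/andP[K0 Ke] /eqP eK] Kmax.
set P := take K e; set v := drop K.+1 e.
have sP : size P = K by rewrite size_takel // ltnW.
have eE : e = P ++ K :: v by rewrite -[LHS](cat_take_drop K) (drop_nth 0) // eK.
have sv : size e = K + (size v).+1 by rewrite {1}eE size_cat /= sP.
have vE j : nth 0 v j = nth 0 e (K + j.+1) by rewrite nth_drop addSnnS.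
have iP : invs P by move=> i; rewrite sP => iK; rewrite nth_take // ie //; lia.
have [nP nv vK] : [/\ nzinc P, nzinc v & forall z, z \in v -> z = 0 \/ K <= z].
  move: ne; rewrite eE /nzinc pairwise_cat /= => /and4P[_ -> /allP h ->]; split=> //.
  by move=> z /h /orP[/eqP|]; auto.
have vlt j : j < size v -> nth 0 v j < K + j.+1.
  move=> hj; have := Kmax (K + j.+1); have := ie (K + j.+1); rewrite /Q vE sv; lia.
have [t1 t1E] : exists t, enc t = P by apply: IH => //; rewrite ?sP //; lia.
(* The last condition keeps nonzero entries nonzero under [unshift], so that [raise] recovers
   them. *)
suff [c [t2 [t2E cs zc]]] : exists c t2, [/\ enc t2 = 0 :: map (unshift K c) v, shift t2 = c
    & forall z, z \in v -> z != 0 -> z - K + c != 0].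
  exists (Glue t1 t2); rewrite /= -/(shift t2) t1E t2E cs [RHS]eE /glueE sP /=; congr (_ ++ _ :: _).
  rewrite -map_comp -[RHS]map_id; apply/eq_in_map => z zv /=; rewrite /raise /unshift.
  have := zc z zv; have := vK z zv; case: eqP => [->//|nz]; case: eqP; lia.
(* Any [c] that leaves the shifted entries on or below the diagonal yields a word of the class. *)
have build c : (forall j, j < size v -> nth 0 v j != 0 -> nth 0 v j - K + c <= j.+1) ->
    exists t2, enc t2 = 0 :: map (unshift K c) v.
  move=> hc; apply: IH => //.
  - by rewrite /= size_map; lia.
  - case=> //= j; rewrite size_map ltnS => hj; rewrite (nth_map 0) // /unshift.
    by case: (eqVneq (nth 0 v j) 0) => // /(hc _ hj).
  - rewrite /nzinc /=; apply/andP; split; first by apply/allP => z _; rewrite leq0n orbT.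
    rewrite pairwise_map; apply/(pairwiseP 0) => i j; rewrite !inE => hi hj ij.
    have := nzincP _ nv i j; rewrite ij => /(_ hj); rewrite /relpre /unshift /=.
    by case: (nth 0 v i =P 0) => ?; case: (nth 0 v j =P 0) => ?; lia.
have nthu c j : j < size v -> nth 0 (map (unshift K c) v) j = unshift K c (nth 0 v j).
  by move=> hj; rewrite (nth_map 0).
(* If [K] does not recur, shift 0 works: nonzero entries of [v] exceed [K], and the second word has
   no maximal entry after its first. *)
case: (boolP (K \in v)) => Kv; last first.
  exists 0; have [j hj _|t2 t2E] := build 0; first by have := vlt _ hj; lia.
  exists t2; split=> //.
    apply: (enc_shift t2E) => // -[[|j] //=]; rewrite size_map ltnS => hj.
    rewrite nthu // /unshift; have := vlt _ hj; case: (nth 0 v j =P 0) => //; lia.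
  move=> z zv nz; have := vK z zv; have : z != K by apply: contraNneq Kv => <-.
  lia.
(* If [K] recurs, [c] is the least distance to the diagonal of a nonzero entry, hence the largest
   admissible shift. Where it is attained a maximal entry arises, and [K] itself becomes [c], the
   least nonzero entry. *)
pose W c := has (fun j => (nth 0 v j != 0) && (K + j.+1 - nth 0 v j == c)) (iota 0 (size v)).
have [jK hjK ejK] := nthnP _ _ Kv.
have exW : exists c, W c.
  exists jK.+1; apply/hasP; exists jK; rewrite ?mem_iota ?ejK //; lia.
case: (ex_minnP exW) => c /hasP[t]; rewrite mem_iota => ht /andP[tnz /eqP tc] cmin.
have {}cmin j : j < size v -> nth 0 v j != 0 -> c <= K + j.+1 - nth 0 v j.
  by move=> hj nz; apply: cmin; apply/hasP; exists j; rewrite ?mem_iota //= nz eqxx.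
have vge j : j < size v -> nth 0 v j != 0 -> K <= nth 0 v j.
  by move=> hj nz; case: (vK _ (mem_nthn hj)) => // z0; rewrite z0 in nz.
have c0 : 0 < c by have := vlt t; lia.
exists c; have [j hj nz|t2 t2E] := build c.
  have := cmin _ hj nz; have := vge _ hj nz; have := vlt _ hj; lia.
exists t2; split=> //; last by move=> *; lia.
apply: (enc_shift t2E) => //.
- by move=> _ /mapP[z zv ->]; rewrite /unshift; case: (z =P 0) => // _ _; rewrite leq_addl.
- move=> _; split.
    apply/mapP; exists K => //; rewrite /unshift; case: (K =P 0); lia.
  exists t.+1; first by rewrite /= size_map; lia.
  have ht' : t < size v by lia.
  rewrite /= nthu // /unshift (negbTE tnz).
  have := vge _ ht' tnz; have := vlt _ ht'; lia.
Qed.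

Lemma seq_min (u : seq nat) : 0 < size u -> exists2 m, m \in u & forall y, y \in u -> m <= y.
Proof.
elim: u => // y [|z u] IH _; first by exists y => [|w]; rewrite inE // => /eqP->.
have [//|m mu hm] := IH; case: (leqP y m) => ym.
  exists y; first by rewrite inE eqxx.
  by move=> w; rewrite inE => /orP[/eqP->//|/hm]; apply: leq_trans.
exists m; first by rewrite inE mu orbT.
by move=> w; rewrite inE => /orP[/eqP->|/hm//]; apply: ltnW.
Qed.

(** The letters [m] and [y], in either order, followed by 1 and [z], form 2413 or 4213. *)
Lemma bad_between u v m y z :
  m \in u -> y \in u -> z \in v -> 1 < m -> m < z < y -> bad (u ++ 1 :: v).
Proof.
move=> mu yu zv m1 mzy.
exists (index m u), (index y u), (size u), (size u + (index z v).+1).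
have nthu w : w \in u -> nth 0 (u ++ 1 :: v) (index w u) = w.
  by move=> wu; rewrite nth_zoneL ?index_mem ?nth_index.
rewrite (nthu _ mu) (nthu _ yu) nth_zoneM nth_zoneR nth_index // m1.
split; last by case/andP: mzy => -> ->.
by split; rewrite ?size_cat ?ltn_add2l ?ltnS ?index_mem // addnS ltnS leq_addr.
Qed.

Lemma dec_surj p : 0 < size p -> isp p -> ~ bad p -> exists t, dec t = p.
Proof.
have [n] := ubnP (size p); elim: n p => // n IH p pn p0 pp bp.
have p1 : 1 \in p by rewrite pp.2.
have [head1|/eqP head1] := eqVneq (head 0 p) 1.
  case: p => [//|y w] in pn p0 pp bp p1 head1 *; rewrite /= in head1; subst y.
  have w1 z : z \in w -> 1 < z.
    move=> zw; case: pp => /= /andP[h _] /(_ z); rewrite inE zw orbT => hz.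
    have : z != 1 by apply: contraNneq h => <-.
    lia.
  have wE : w = map succn (map predn w).
    rewrite -map_comp -[LHS]map_id; apply/eq_in_map => z /w1 /=; lia.
  case w0 : (size w) => [|sw].
    by exists Leaf; rewrite (size0nil w0).
  have [t tE] : exists t, dec t = map predn w; last by exists (Under t); rewrite /= tE -wE.
  have sE : size (map predn w) = size w by rewrite size_map.
  apply: IH; rewrite ?sE ?w0 //.
  - by move: pn; rewrite /= w0.
  - case: pp => /= /andP[_ uw] mw; apply: isp_uniq.
      by rewrite map_inj_in_uniq // => z z' /w1 ? /w1; lia.
    move=> y /mapP[z zw ->]; rewrite sE; have := w1 _ zw; have := mw z; rewrite inE zw orbT /=; lia.
  - by rewrite -under_bad -wE.
set K := index 1 p; set u := take K p; set v := drop K.+1 p.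
have Kp : K < size p by rewrite index_mem.
have pK : nth 0 p K = 1 by rewrite nth_index.
have K0 : 0 < K.
  by rewrite lt0n; apply/eqP => E; move: pK; rewrite E nth0.
have su : size u = K by rewrite size_takel // ltnW.
have pE : p = u ++ 1 :: v by rewrite -[LHS](cat_take_drop K) (drop_nth 0) // pK.
have sp : size p = K + (size v).+1 by rewrite {1}pE size_cat /= su.
case: pp => up mp.
have [uu u1 uv] : [/\ uniq u, 1 \notin u & forall y, y \in u -> y \notin v].
  move: up; rewrite pE cat_uniq /= negb_or => /and4P[-> /andP[-> /hasPn h] _ _]; split=> //.
  by move=> y yu; apply/negP => /h; rewrite /= yu.
have [v1 uqv] : 1 \notin v /\ uniq v.
  by move: up; rewrite pE cat_uniq /= => /and4P[].
have [m mu um] := seq_min (leq_trans K0 (eq_leq (esym su))).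
have pos y : y \in u -> 0 < y.
  by move=> yu; have := mp y; rewrite pE mem_cat yu; lia.
have posv y : y \in v -> 1 < y <= size p.
  move=> yv; have := mp y; rewrite pE mem_cat inE yv !orbT -pE.
  have : y != 1 by apply: contraNneq v1 => <-.
  lia.
have m1 : 1 < m.
  have := pos _ mu; have : m != 1 by apply: contraNneq u1 => <-.
  lia.
(* A value missing from [u] between its minimum and another of its letters would stand after 1 and
   give a forbidden pattern. Thus [u] is an interval of values. *)
have between y z : y \in u -> m <= z <= y -> z \in u.
  move=> yu /andP[]; rewrite leq_eqVlt => /orP[/eqP <-//|mz].
  rewrite leq_eqVlt => /orP[/eqP ->//|zy].
  have /andP[_ yp] : 0 < y <= size p by rewrite -mp pE mem_cat yu.
  have : z \in p by rewrite mp (ltn_trans _ mz) ?(ltnW m1) // (leq_trans (ltnW zy)).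
  rewrite pE mem_cat inE => /or3P[//|/eqP z1|zv]; first by rewrite z1 ltnNge ltnW in mz.
  by case: bp; rewrite pE; apply: (bad_between mu yu zv m1); rewrite mz zy.
have ule y : y \in u -> y < m + K.
  move=> yu; rewrite -su; have : size (iota m (y - m).+1) <= size u; last first.
    by rewrite size_iota; have := um _ yu; lia.
  apply: uniq_leq_size; first exact: iota_uniq.
  by move=> z; rewrite mem_iota => hz; apply: (between y) => //; have := um _ yu; lia.
have uE z : (z \in u) = (m <= z < m + K).
  have [||_ ->] := @uniq_min_size _ u (iota m K) uu; rewrite ?mem_iota ?size_iota ?su //.
  by move=> y yu; rewrite mem_iota um // ule.
(* [glueP] puts the block on [x + 1, ..., x + K], and [u] fills [m, ..., m + K - 1]. [L] and [R]
   undo the translation and [spread]. *)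
pose x := m.-1.
pose L := map (subn^~ x) u.
pose R := map (fun r => if r <= x then r.-1 else r - K) v.
have vb r : r \in v -> 1 < r <= x \/ x + K < r <= size p.
  move=> rv; have := posv r rv; have : r \notin u by apply/negP => /uv; rewrite rv.
  rewrite uE /x; lia.
have xK : x + K <= size p.
  have mK : m + K.-1 \in u by rewrite uE; lia.
  by have := mp (m + K.-1); rewrite {1}pE mem_cat mK /x; lia.
have sL : size L = K by rewrite size_map.
have sR : size R = size v by rewrite size_map.
have glue : p = glueP L (x :: R).
  rewrite /glueP /= sL {1}pE -!map_comp; congr (_ ++ _ :: _).
    by rewrite -[LHS]map_id; apply/eq_in_map => y; rewrite uE /x /=; lia.
  rewrite -[LHS]map_id; apply/eq_in_map => r /vb /= rb; rewrite /spread.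
  case: (leqP r x) => h; [case: (ltnP r.-1 x) | case: (ltnP (r - K) x)]; lia.
have pL : isp L.
  apply: isp_uniq.
    by rewrite map_inj_in_uniq // => y z; rewrite !uE /x; lia.
  by move=> _ /mapP[y + ->]; rewrite sL uE /x; lia.
have pR : isp (x :: R).
  apply: isp_uniq => /=.
    apply/andP; split.
      by apply/mapP => -[r /vb]; case: (leqP r x); lia.
    by rewrite map_inj_in_uniq // => r r' /vb ? /vb ?; case: (leqP r x); case: (leqP r' x); lia.
  move=> y; rewrite inE sR => /orP[/eqP->|/mapP[r /vb ? ->]]; last by case: (leqP r x); lia.
  rewrite /x; lia.
have nb : ~ (bad L \/ bad (x :: R)) by rewrite -glueP_bad ?sL // -glue.
have [t1 t1E] : exists t, dec t = L.
  by apply: IH; rewrite ?sL //; [lia | move=> b; apply: nb; left].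
have [t2 t2E] : exists t, dec t = x :: R.
  by apply: IH; rewrite //= ?sR; [lia | move=> b; apply: nb; right].
by exists (Glue t1 t2); rewrite /= t1E t2E.
Qed.

(** * Patterns and position sets *)

(** Trades masks for increasing lists of indices, so that occurrences can be given by their
    positions. *)
Lemma containsP w p : contains w p <-> exists s,
  [/\ size s = size p, sorted ltn s, all (fun i => i < size w) s & order_iso (map (nth 0 w) s) p].
Proof.
have wE : w = map (nth 0 w) (iota 0 (size w)) by rewrite -/(mkseq _ _) mkseq_nth.
split=> [[m [sm om]]|[s [ss os aw oi]]].
  exists (mask m (iota 0 (size w))).
  have E : map (nth 0 w) (mask m (iota 0 (size w))) = mask m w by rewrite map_mask -wE.
  rewrite E; split=> //.
  - by rewrite -(size_map (nth 0 w)) E; case: om.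
  - by apply: (subseq_sorted ltn_trans (mask_subseq _ _)); apply: iota_ltn_sorted.
  - by apply/allP => i /mem_mask; rewrite mem_iota.
have sub : subseq s (iota 0 (size w)).
  suff -> : s = [seq i <- iota 0 (size w) | i \in s] by apply: filter_subseq.
  apply: (irr_sorted_eq ltn_trans ltnn) => //.
    by apply: (sorted_filter ltn_trans); apply: iota_ltn_sorted.
  move=> i; rewrite mem_filter mem_iota /=.
  by case: (boolP (i \in s)) => // /(allP aw) ->.
have [m sm sE] := subseqP sub; exists m; split; first by rewrite sm size_iota.
by rewrite wE -map_mask -sE.
Qed.

(** The leading 0 completes any descent between nonzero entries to an occurrence of 021; conversely
    the last two letters of an occurrence are such a descent. *)
Lemma avoids_021 e : invs e -> (avoids e [:: 0; 2; 1] <-> nzinc e).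
Proof.
move=> ie; split=> [av|/nzincP ne /containsP[[|a [|b [|c [|? ?]]]] [] //]].
  apply/nzincP => i j /andP[ij je]; case: (eqVneq (nth 0 e j) 0) => [|nz]; [by left|right].
  rewrite leqNgt; apply/negP => lt; apply: av; apply/containsP; exists [:: 0; i; j].
  have e0 : nth 0 e 0 = 0 by have := ie 0 (leq_ltn_trans (leq0n j) je); rewrite leqn0 => /eqP.
  have i0 : 0 < i by case: i lt {ij} => //; rewrite e0.
  split=> //=; [by rewrite i0 ij | by rewrite je (ltn_trans ij je) (leq_ltn_trans _ je) |].
  by split=> // -[|[|[|a]]] [|[|[|b]]] //= _ _; rewrite ?e0; split; lia.
move=> _ /= /and3P[ab bc _] /and4P[_ _ hc _] [_ oi].
have := (oi 0 2 isT isT).1; have := (oi 2 1 isT isT).1; rewrite /= => h1 h2.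
by have := ne b c; rewrite bc hc => /(_ isT); lia.
Qed.

Lemma badE w : bad w <-> contains w [:: 2; 4; 1; 3] \/ contains w [:: 4; 2; 1; 3].
Proof.
split=> [[i [j [k [l [[ik jk kl lw] v]]]]]|].
  case: (ltngtP i j) => ij; last by rewrite ij in v; lia.
    left; apply/containsP; exists [:: i; j; k; l]; split=> //=; [by rewrite ij jk kl | lia |].
    by split=> // -[|[|[|[|a]]]] [|[|[|[|b]]]] //= _ _; split; lia.
  right; apply/containsP; exists [:: j; i; k; l]; split=> //=; [by rewrite ij ik kl | lia |].
  by split=> // -[|[|[|[|a]]]] [|[|[|[|b]]]] //= _ _; split; lia.
case=> /containsP[[|a [|b [|c [|d [|? ?]]]]] [] //] _ /= /and4P[ab bc cd _].
  case/and5P=> _ _ _ hd _ [_ oi]; exists a, b, c, d.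
  have := (oi 2 0 isT isT).1; have := (oi 0 3 isT isT).1; have := (oi 3 1 isT isT).1.
  by rewrite /= => h1 h2 h3; split; [split|]; lia.
case/and5P=> _ _ _ hd _ [_ oi]; exists b, a, c, d.
have := (oi 2 1 isT isT).1; have := (oi 1 3 isT isT).1; have := (oi 3 0 isT isT).1.
by rewrite /= => h1 h2 h3; split; [split|]; lia.
Qed.

Lemma S_permE n p : S2413_4213 n p <-> [/\ size p = n, isp p & ~ bad p].
Proof.
have [bc cb] := badE p; split=> [[/is_permE[ip sp] [a b]]|[sp ip nb]].
  by split=> // /bc[].
by do !split; [apply/is_permE | move=> h; apply: nb; apply: cb; left
             | move=> h; apply: nb; apply: cb; right].
Qed.

Lemma I021E n e : I021 n e <-> [/\ size e = n, invs e & nzinc e].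
Proof.
have iE : is_invseq n e <-> size e = n /\ invs e.
  split=> -[se h]; split=> //.
    by move=> i hi; have := h i.+1; rewrite /letter /= -se hi subn1; apply.
  by move=> [|i] // hi; have := h i; rewrite /letter /= se subn1; apply; case/andP: hi.
split=> [[/iE[se ie] /avoids_021 ne]|[se ie ne]]; first by split=> //; apply: ne.
by split; [apply/iE | apply/avoids_021].
Qed.

(** * From 1-indexed position sets to the 0-indexed statistics *)

Lemma forall_drop w i (Q : pred nat) :
  [forall j : 'I_(size w).+1, (i.+1 < j) ==> Q (letter w j)] = all Q (drop i.+1 w).
Proof.
apply/forallP/(all_nthP 0) => [h j|h [[|j] hj] //=].
  rewrite size_drop nth_drop => hj; have lt : i.+1 + j.+1 < (size w).+1 by lia.
  have /implyP := h (Ordinal lt); rewrite /= /letter addnS /=; apply; lia.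
apply/implyP => ij; have := h (j - i.+1); rewrite size_drop nth_drop subnKC //; apply.
by rewrite ltn_sub2r //; lia.
Qed.

Lemma forall_take w i (Q : pred nat) : i < size w ->
  [forall j : 'I_(size w).+1, (0 < j < i.+1) ==> Q (letter w j)] = all Q (take i w).
Proof.
move=> iw; apply/forallP/(all_nthP 0) => [h j|h [[|j] hj] //=].
  rewrite size_takel ?(ltnW iw) // => ji; rewrite nth_take //.
  have lt : j.+1 < (size w).+1 by lia.
  by have /implyP := h (Ordinal lt); rewrite /= ltnS; apply.
apply/implyP; rewrite ltnS => ji; have := h j; rewrite size_takel ?(ltnW iw) // nth_take //; exact.
Qed.

Lemma posset_eq u v P Q : size u = size v ->
  (forall i, i < size u -> P i.+1 = Q i.+1) -> posset u P = posset v Q.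
Proof.
move=> suv h; rewrite /posset -suv; apply: eq_in_filter => -[|i]; rewrite mem_iota //= => hi.
by apply: h; lia.
Qed.

Lemma DIST_pred e : invs e -> DIST e = posset e (fun i => dist e i.-1).
Proof.
move=> ie; apply: posset_eq => // i hi; rewrite (forall_drop e i (fun y => letter e i.+1 != y)).
rewrite /dist /letter /=.
have -> : all (fun y => nth 0 e i != y) (drop i.+1 e) = (nth 0 e i \notin drop i.+1 e).
  by rewrite -has_pred1 -all_predC; apply: eq_all => y /=; rewrite eq_sym.
by case: i hi => //= /ie; rewrite leqn0 => /eqP ->.
Qed.

(** A successor found in the prefix is a value of the permutation, which gives the bound in [VID].
    An absent value has index [size p], so it never counts as lying to the left. *)
Lemma VID_pred p : isp p -> VID p = posset p (fun i => vid p i.-1).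
Proof.
move=> [_ mp]; apply: posset_eq => // i hi; rewrite /vid /posof /letter /= ltnS.
rewrite (in_take_leq _ (ltnW hi)); apply/andb_idl => lt.
by have := mp (nth 0 p i).+1; rewrite -index_mem (ltn_trans lt hi).
Qed.

(** Under [nzinc] the value $d_i$ is the prefix maximum in both cases of [dval]; the rest is a
    change of indexing. *)
Lemma expo_pred e i : nzinc e -> i < size e ->
  ~~ covered e i.+1 && [forall j : 'I_(size e).+1,
     (i.+1 < j) ==> (i.+1 - dval e i.+1 < j - dval e j)] = expo e i.
Proof.
move=> ne hi.
have dE j : dval e j.+1 = pmax e j.
  by rewrite /dval /letter /=; case: ifP => // nz; rewrite pmax_nz.
rewrite /expo; congr (~~ _ && _).
  rewrite /covered /cov /letter /=; congr (_ && _).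
  apply/existsP/hasP => [[[[|a] ha] /existsP[[b hb] //= /and4P[ai ib ab nz]]]|[y]].
    exists (nth 0 e a); rewrite ?nz /=.
      by rewrite -(nth_take 0 (ltnSE ai)) mem_nthn // size_takel ?(ltnW hi).
    rewrite (eqP ab); apply/nthnP; exists (b.-1 - i.+1).
      by rewrite size_drop; lia.
    by rewrite nth_drop; congr nth; lia.
  case/nthnP=> a; rewrite size_takel ?(ltnW hi) // => ai; rewrite nth_take // => <-.
  case/andP=> nz /nthnP[b]; rewrite size_drop nth_drop => hb be.
  have ha : a.+1 < (size e).+1 by lia.
  have hb' : (i.+1 + b).+1 < (size e).+1 by rewrite ltnS -ltn_subRL.
  exists (Ordinal ha); apply/existsP; exists (Ordinal hb') => /=.
  by rewrite be nz eqxx; lia.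
apply/forallP/forallP => h.
  move=> [j hj]; have hj' : j.+1 < (size e).+1 by [].
  by have := h (Ordinal hj'); rewrite /= !dE ltnS.
move=> [[|j] hj] //; have hj' : j < size e by [].
by have := h (Ordinal hj'); rewrite /= !dE ltnS.
Qed.

Theorem theorem1p2 (n : nat) (hn : 1 <= n) :
  exists Psi : seq nat -> seq nat,
    (forall e, I021 n e -> S2413_4213 n (Psi e)) /\
    (forall e1 e2, I021 n e1 -> I021 n e2 -> Psi e1 = Psi e2 -> e1 = e2) /\
    (forall p, S2413_4213 n p -> exists2 e, I021 n e & Psi e = p) /\
    (forall e, I021 n e ->
       DIST e = VID (Psi e) /\ ASC e = DES (Psi e) /\ ZERO e = LMA (Psi e) /\
       EMA e = LMI (Psi e) /\ RMIe e = RMA (Psi e) /\ EXPO e = RMIp (Psi e)).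
Proof.
(* [tr] is a chosen inverse of [enc]; outside the class its value is arbitrary. *)
pose tr e := epsilon (inhabits Leaf) (fun t => enc t = e).
have trK t : tr (enc t) = t.
  by apply: enc_inj; apply: (epsilon_spec (inhabits Leaf) (fun t' => enc t' = enc t)); exists t.
have encI e : I021 n e -> exists2 t, weight t = n & e = enc t.
  move=> /I021E[se ie ne]; have [|t tE] := enc_surj _ ie ne; first by rewrite se.
  by exists t => //; have [<- _ _ _ _] := enc_spec t; rewrite tE.
exists (dec \o tr); split; [|split; [|split]] => /=.
- move=> _ /encI[t tn ->]; rewrite trK; apply/S_permE.
  by have [sd pd bd _] := dec_spec t; rewrite sd.
- by move=> _ _ /encI[t1 _ ->] /encI[t2 _ ->]; rewrite !trK => /dec_inj ->.
- move=> p /S_permE[sp ip nb]; have [|t tE] := dec_surj _ ip nb; first by rewrite sp.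
  exists (enc t); last by rewrite trK.
  have [se ie ne _ _] := enc_spec t; apply/I021E; split=> //.
  by have [sd _ _ _] := dec_spec t; rewrite se -sd tE.
- move=> _ /encI[t tn ->]; rewrite trK.
  have [se ie ne _ _] := enc_spec t; have [sd pd _ _] := dec_spec t.
  have ss : size (enc t) = size (dec t) by rewrite se sd.
  do ?split.
  + rewrite DIST_pred // VID_pred //; apply: posset_eq => // i.
    by rewrite se => /tree_stat[[]].
  + apply: posset_eq => // i hi; have := hi; rewrite se => /tree_stat[[_ + _] _].
    by rewrite /asc /desc /letter /=; congr (_ && _ = _ && _); lia.
  + apply: posset_eq => // i hi; rewrite (forall_take (fun y => y < letter (dec t) i.+1)) -?ss //.
    by move: hi; rewrite se => /tree_stat[[_ _ ->]].
  + apply: posset_eq => // i hi; rewrite (forall_take (fun y => letter (dec t) i.+1 < y)) -?ss //.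
    by rewrite subn1; move: hi; rewrite se => /tree_stat[_ [->]].
  + apply: posset_eq => // i hi; rewrite (forall_drop _ i (fun y => letter (enc t) i.+1 < y)).
    rewrite (forall_drop _ i (fun y => y < letter (dec t) i.+1)).
    by move: hi; rewrite se => /tree_stat[_ [_]].
  + apply: posset_eq => // i hi; rewrite expo_pred //.
    rewrite (forall_drop _ i (fun y => letter (dec t) i.+1 < y)).
    by move: hi; rewrite se => /tree_stat[_ [_ _]].
Qed.
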